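(* Let $Z_1, Z_2, \ldots$ be independent, identically distributed random vectors in $\mathbb{R}^2$ with $\mathbb{E}[\|Z_1\|^2] < \infty$ and $\|\mathbb{E}[Z_1]\| \neq 0$. Let $S_0 := 0$ and $S_n := \sum_{i=1}^n Z_i$ for $n \geq 1$, and let $L_n$ denote the length of the perimeter of the convex hull of $\{S_0, S_1, \ldots, S_n\}$. Then \[ \lim_{n \to \infty} n^{-1} \operatorname{Var}[L_n] = \frac{4\, \mathbb{E}\big[ \big( (Z_1 - \mathbb{E}[Z_1]) \cdot \mathbb{E}[Z_1] \big)^2 \big]}{\|\mathbb{E}[Z_1]\|^2} =: \sigma^2 \in [0,\infty). \]
   Context: $\cdot$ denotes the Euclidean inner product and $\|\cdot\|$ the Euclidean norm on $\mathbb{R}^2$. *)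

(* Defs.v *)
From HB Require Import structures.
From mathcomp Require Import all_boot all_order all_algebra.
From mathcomp Require Import all_classical all_reals all_analysis.
Set Implicit Arguments. Unset Strict Implicit. Unset Printing Implicit Defensive.
Import Order.TTheory GRing.Theory Num.Theory.
Local Open Scope classical_set_scope.
Local Open Scope ring_scope.

Section plane.
Variable R : realType.

(* Euclidean geometry of R^2, written explicitly on pairs (the library's
   norm on R * R is the max-norm, so we do not use it). *)
Definition vsub (a b : R * R) : R * R := (a.1 - b.1, a.2 - b.2).
Definition dotp (u v : R * R) : R := u.1 * v.1 + u.2 * v.2.
Definition cross (u v : R * R) : R := u.1 * v.2 - u.2 * v.1.
Definition enorm (u : R * R) : R := Num.sqrt (dotp u u).

(* (a,b) is a counterclockwise edge of the convex hull of the finite point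
   set s: a <> b, every point of s lies (weakly) to the left of the directed
   line a->b, and points of s on that line lie in the segment [a,b]. *)
Definition hull_edge (s : seq (R * R)) (a b : R * R) : bool :=
  (a != b) &&
  all (fun c => (0 <= cross (vsub b a) (vsub c a)) &&
        ((cross (vsub b a) (vsub c a) == 0) ==>
           (0 <= dotp (vsub c a) (vsub b a) <= dotp (vsub b a) (vsub b a)))) s.

(* Perimeter length of the convex hull of the finite point set s: the sum of
   the lengths of its edges (for a degenerate hull that is a segment, this is
   twice the segment length; for a single point it is 0). *)
Definition hull_perimeter (s : seq (R * R)) : R :=
  \sum_(a <- undup s) \sum_(b <- undup s | hull_edge s a b) enorm (vsub b a).

End plane.

Section proba.
Context {d : measure_display} {T : measurableType d} {R : realType}.

Definition mutually_independent (P : probability T R) (Z : nat -> T -> R * R) :=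
  forall (s : seq nat), uniq s ->
  forall (A : nat -> set (R * R)), (forall i, measurable (A i)) ->
    P (\bigcap_(i in [set i | i \in s]) (Z i @^-1` A i)) =
    (\prod_(i <- s) P (Z i @^-1` A i))%E.

Definition identically_distributed (P : probability T R) (Z : nat -> T -> R * R) :=
  forall (i : nat) (A : set (R * R)), measurable A ->
    P (Z i @^-1` A) = P (Z 0%N @^-1` A).

(* Random walk S_k = Z_1 + ... + Z_k (with Z_1 represented by Z 0). *)
Definition walk (Z : nat -> T -> R * R) (k : nat) (w : T) : R * R :=
  (\sum_(i < k) (Z i w).1, \sum_(i < k) (Z i w).2).

Definition hull_length (Z : nat -> T -> R * R) (n : nat) (w : T) : R :=
  hull_perimeter [seq walk Z k w | k <- iota 0 n.+1].

Definition mean_vec (P : probability T R) (Z : nat -> T -> R * R) : R * R :=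
  (fine 'E_P[fun w => (Z 0%N w).1], fine 'E_P[fun w => (Z 0%N w).2]).

End proba.

(* Main.v *)
Require Import Defs.
From HB Require Import structures.
From mathcomp Require Import all_boot all_order all_algebra.
From mathcomp Require Import all_classical all_reals all_analysis.
From mathcomp Require Import measurable_realfun ring lra zify.
Import Order.TTheory GRing.Theory Num.Theory.
Local Open Scope classical_set_scope.
Local Open Scope ring_scope.

(* Let [e] be the direction of the drift [mu] and [W u] the extent of the walk in
   the direction [u]. Summed over the hull edges, [|(b - a) . u|] is [2 * W u],
   because every level strictly between the extremes is crossed by exactly one
   rising and one falling edge. Comparing the Euclidean norm with a polyhedral
   norm that is exact along [e] gives [2 S_n . e <= L_n <= 2 S_n . e + F_n], where
   [F_n] combines the quantities [max_k (S_k - S_n) . u] and [max_k (- S_k . u)]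
   for finitely many [u]. Each of these follows a Lindley recursion
   [D' = max 0 (D - X)]: squaring it yields [E D^2 = O(n)] without drift, and with
   positive drift first [sum_k E D_k = O(n)], and then [E D^2 = o(n)] by applying
   the same argument to [((D - 2 t)^+)^2]. The driftless directions carry an
   arbitrarily small weight, so [E F_n^2 = o(n)], and the variance of [L_n] agrees
   with that of [2 S_n . e] up to [o(n)]. *)

(** * Edges of planar convex hulls *)

(** Across the drift the walk fluctuates by order [sqrt n], so an error from that direction can have
    second moment of order [n], the size of the variance itself. A polyhedral norm that is exact
    along [e] and gives the orthogonal direction only the weight [a] reduces this to order [a^2 n].
    Steep vectors are charged instead to the directions [a e + e'] and [a e - e'], with [e'] the
    quarter turn of [e]. Their drift [a |mu|] is small but positive, and positivity is all that the
    [o(n)] bound asks for. With only two moments, [E D^2] need not stay bounded even under drift;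
    uniform integrability of the squared steps gives [o(n)], which is enough. The perimeter enters
    only through pointwise bounds, so its variance is compared with that of [2 S_n . e] without
    establishing its measurability. *)

Lemma sum_consecutive_gaps {R : realFieldType} (v : seq R) (x y : R) :
  sorted <%R v -> x \in v -> y \in v -> x <= y ->
  \sum_(0 <= i < (size v).-1) (v`_i.+1 - v`_i) *
     (x < (v`_i + v`_i.+1) / 2 < y)%R%:R = y - x.
Proof.
move=> sv xv yv xy.
have nth_lt i j : (i < j)%N -> (j < size v)%N -> v`_i < v`_j.
  by move=> ij jv; rewrite (lt_sorted_ltn_nth 0 sv)// inE (ltn_trans ij jv).
have nth_le i j : (i <= j)%N -> (j < size v)%N -> v`_i <= v`_j.
  rewrite leq_eqVlt => /predU1P[->//|ij jv]; exact/ltW/nth_lt.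
set i0 := index x v; set j0 := index y v.
have i0v : (i0 < size v)%N by rewrite index_mem.
have j0v : (j0 < size v)%N by rewrite index_mem.
have xE : v`_i0 = x by rewrite nth_index.
have yE : v`_j0 = y by rewrite nth_index.
have ij0 : (i0 <= j0)%N.
  by rewrite leqNgt; apply/negP => /nth_lt/(_ i0v); rewrite xE yE ltNge xy.
have j0s : (j0 <= (size v).-1)%N by rewrite -ltnS (ltn_predK j0v).
have v1 i : (i < (size v).-1)%N -> (i.+1 < size v)%N.
  by move=> iv; rewrite -(ltn_predK i0v) ltnS.
(* Midpoints of gaps before [i0] lie below [x], those of gaps from [j0] on lie above [y]; the
   lengths in between telescope. *)
rewrite (big_cat_nat (n := i0))//=; last exact: leq_trans j0s.
rewrite [X in X + _]big_nat_cond big1 ?add0r; last first.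
  move=> i /andP[/andP[_ ii0] _]; rewrite [X in nat_of_bool X](_ : _ = false) ?mulr0//.
  apply/negbTE; rewrite negb_and -leNgt; apply/orP; left.
  have : v`_i < v`_i.+1 by apply: nth_lt => //; exact: leq_ltn_trans i0v.
  have := nth_le _ _ ii0 i0v; rewrite xE => h1 h2.
  by rewrite ler_pdivrMr// mulr_natr mulr2n; apply: lerD => //; exact/ltW/(lt_le_trans h2).
rewrite (big_cat_nat (n := j0))//=.
rewrite [X in _ + X]big_nat_cond [X in _ + X]big1 ?addr0; last first.
  move=> i /andP[/andP[j0i iv] _]; rewrite [X in nat_of_bool X](_ : _ = false) ?mulr0//.
  apply/negbTE; rewrite negb_and -!leNgt; apply/orP; right.
  have h2 : v`_i < v`_i.+1 by apply: nth_lt => //; exact: v1.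
  have : y <= v`_i by rewrite -yE; apply: nth_le => //; exact: ltnW (v1 _ iv).
  lra.
rewrite big_nat_cond (eq_bigr (fun i => v`_i.+1 - v`_i)); last first.
  move=> i /andP[/andP[i0i ij] _].
  have h2 : v`_i < v`_i.+1 by apply: nth_lt => //; exact: leq_ltn_trans j0v.
  have h1 : x <= v`_i by rewrite -xE; apply: nth_le => //; exact: ltn_trans j0v.
  have h3 : v`_i.+1 <= y by rewrite -yE; apply: nth_le.
  suff -> : (x < (v`_i + v`_i.+1) / 2 < y) = true by rewrite mulr1.
  by apply/andP; split; lra.
by rewrite -big_nat_cond telescope_sumr// xE yE.
Qed.

(* Integrating the number of intervals over each level; the finite set [s] of
   exceptional levels does not matter. *)
Lemma sum_interval_lengths {R : realFieldType} (I : eqType) (r : seq I)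
    (P : pred I) (f g : I -> R) (s : seq R) (m M : R) :
  m \in s -> M \in s -> m <= M -> (forall x, x \in s -> m <= x <= M) ->
  (forall i, i \in r -> P i -> [/\ f i \in s, g i \in s & f i <= g i]) ->
  (forall t, t \notin s -> m < t < M ->
     \sum_(i <- r | P i) (f i < t < g i)%R%:R = 1 :> R) ->
  \sum_(i <- r | P i) (g i - f i) = M - m.
Proof.
move=> ms Ms mM smM fgs cover.
pose v := sort <=%R (undup s).
have vs x : (x \in v) = (x \in s) by rewrite mem_sort mem_undup.
have sv : sorted <%R v by rewrite sort_lt_sorted undup_uniq.
rewrite -(sum_consecutive_gaps _ _ _ sv _ _ mM) ?vs//.
rewrite big_seq_cond.
(* All lengths are cut along the same gaps, so the two sums can be exchanged; [cover] at the
   midpoint then counts each gap once. *)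
rewrite (eq_bigr (fun i => \sum_(0 <= k < (size v).-1) (v`_k.+1 - v`_k) *
     (f i < (v`_k + v`_k.+1) / 2 < g i)%R%:R)); last first.
  move=> i /andP[ir Pi]; have [fs gs fg] := fgs i ir Pi.
  by rewrite sum_consecutive_gaps ?vs.
rewrite exchange_big/= !big_nat; apply: eq_bigr => k /andP[_ kv].
have k1v : (k.+1 < size v)%N by move: kv; case: (size v).
have kv' := ltnW k1v.
rewrite -mulr_sumr -big_seq_cond; congr (_ * _).
have h1 : v`_k < v`_k.+1 by rewrite (lt_sorted_ltn_nth 0 sv)// inE.
have bnd j : (j < size v)%N -> m <= v`_j <= M.
  by move=> jv; apply: smM; rewrite -vs mem_nth.
have /andP[mk _] := bnd _ kv'; have /andP[_ Mk] := bnd _ k1v.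
have mt : m < (v`_k + v`_k.+1) / 2 < M by apply/andP; split; lra.
(* No entry of the sorted list lies strictly between two neighbours, so the midpoint is not an
   exceptional level. *)
rewrite mt cover//; apply/negP; rewrite -vs => /(nthP 0)[j jv jE].
have [jk|kj] := leqP j k.
  have : v`_j <= v`_k by rewrite (lt_sorted_leq_nth 0 sv) ?inE.
  by lra.
have : v`_k.+1 <= v`_j by rewrite (lt_sorted_leq_nth 0 sv) ?inE.
by lra.
Qed.

Lemma exists_min_seq {R : realFieldType} {I : eqType} (f : I -> R) (s : seq I)
    (x : I) : x \in s -> exists2 y, y \in s & forall z, z \in s -> f y <= f z.
Proof.
elim: s x => // a s IH x _.
case: s IH => [_|b s IH].
  by exists a; rewrite ?mem_head// => z; rewrite inE => /eqP ->.
have [y ys ymin] := IH b (mem_head _ _).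
have [fay|fya] := leP (f a) (f y).
  exists a; rewrite ?mem_head// => z; rewrite inE => /predU1P[->//|/ymin].
  exact: le_trans.
exists y; first by rewrite inE ys orbT.
by move=> z; rewrite inE => /predU1P[->|/ymin//]; exact: ltW.
Qed.

Section convex_hull_edges.
Context {R : realType}.
Implicit Types (a b c u v w : R * R) (s : seq (R * R)).

(** Up to the factor [dotp u u], [dotp _ u] and [cross u _] are the coordinates in the orthogonal
    frame of [u] and its quarter turn, and a change of frame preserves determinants. *)
Let dotpE u v w : dotp u u * cross v w = dotp v u * cross u w - cross u v * dotp w u.
Proof. by rewrite /dotp /cross; ring. Qed.

Lemma dotp_vsub u v w : dotp (vsub v w) u = dotp v u - dotp w u.
Proof. by rewrite /dotp /vsub /=; ring. Qed.

Lemma cross_vsub u v w : cross u (vsub v w) = cross u v - cross u w.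
Proof. by rewrite /cross /vsub /=; ring. Qed.

Lemma dotp_ge0 v : 0 <= dotp v v.
Proof. by rewrite /dotp addr_ge0// -expr2 sqr_ge0. Qed.

Lemma dotp_eq0 v : (dotp v v == 0) = (v == 0).
Proof.
rewrite /dotp -!expr2 paddr_eq0 ?sqr_ge0// !sqrf_eq0.
by case: v => x y.
Qed.

(** The orientation determinant of [a], [b], [c] with [dotp _ u] as abscissa and [cross u _] as
    height: when [b] comes after [a], it is positive iff [c] lies above the line through them. *)
Let elev u a b c : R := (dotp b u - dotp a u) * (cross u c - cross u a)
   - (cross u b - cross u a) * (dotp c u - dotp a u).

Let elevE u a b c :
  dotp u u * cross (vsub b a) (vsub c a) = elev u a b c.
Proof. by rewrite dotpE !dotp_vsub !cross_vsub. Qed.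

(** For collinear points the position of [c] along [b - a] can be read off the abscissas, which
    turns the segment clause of [hull_edge] into an order between values of [dotp _ u]. *)
Let colinear_dotp u a b c : u != 0 -> elev u a b c = 0 ->
  (dotp b u - dotp a u) * dotp (vsub c a) (vsub b a) =
  (dotp c u - dotp a u) * dotp (vsub b a) (vsub b a).
Proof.
move=> u0 e0; have /mulfI : dotp u u != 0 by rewrite dotp_eq0.
apply; rewrite -!dotp_vsub; apply/eqP; rewrite -subr_eq0; apply/eqP.
transitivity (cross u (vsub b a) * elev u a b c); last by rewrite e0 mulr0.
by rewrite /elev -!dotp_vsub -!cross_vsub /dotp /cross /=; ring.
Qed.

Let rising_edge_spec u s a b : u != 0 -> dotp a u < dotp b u ->
  hull_edge s a b =
  all (fun c => (0 <= elev u a b c) &&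
     ((elev u a b c == 0) ==> (dotp a u <= dotp c u <= dotp b u))) s.
Proof.
move=> u0 ab; rewrite /hull_edge.
have d0 : 0 < dotp u u by rewrite lt0r dotp_eq0 u0 dotp_ge0.
have -> : a != b by apply: contraTneq ab => ->; rewrite ltxx.
apply: eq_in_all => c cs; rewrite -elevE pmulr_rge0//.
rewrite mulf_eq0 (gt_eqF d0)/=; congr (_ && _).
case: eqP => //= e0; have := colinear_dotp u a b c u0.
rewrite -elevE e0 mulr0 => /(_ erefl).
have ab0 : 0 < dotp b u - dotp a u by rewrite subr_gt0.
have vv0 : 0 < dotp (vsub b a) (vsub b a).
  rewrite lt0r dotp_ge0 dotp_eq0 andbT; apply: contraTneq ab0 => e.
  by rewrite -dotp_vsub e /dotp !mul0r addr0 ltxx.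
move=> h; congr (_ && _).
  by rewrite -(pmulr_rge0 _ ab0) h pmulr_lge0// subr_ge0.
by rewrite -(ler_pM2l ab0) h ler_pM2r// lerD2r.
Qed.

(** Each fraction is the height at level [t] of a segment ending at [b]. Cleared of denominators,
    their difference is [dotp b u - t] times [elev u a b c]. *)
Let slope_left u t a b c : dotp a u < dotp b u -> dotp c u < dotp b u ->
  t < dotp b u ->
  (cross u a * (dotp b u - t) + cross u b * (t - dotp a u)) / (dotp b u - dotp a u)
  <= (cross u c * (dotp b u - t) + cross u b * (t - dotp c u)) / (dotp b u - dotp c u)
  -> 0 <= elev u a b c.
Proof.
move=> ab cb tb; rewrite ler_pdivrMr ?subr_gt0// mulrAC ler_pdivlMr ?subr_gt0//.
rewrite -subr_ge0 [X in 0 <= X](_ : _ = (dotp b u - t) * elev u a b c).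
  by rewrite pmulr_rge0 ?subr_gt0.
by rewrite /elev; ring.
Qed.

Let slope_right u t a b c : dotp a u < dotp b u -> dotp a u < dotp c u ->
  dotp a u < t ->
  (cross u a * (dotp b u - t) + cross u b * (t - dotp a u)) / (dotp b u - dotp a u)
  <= (cross u a * (dotp c u - t) + cross u c * (t - dotp a u)) / (dotp c u - dotp a u)
  -> 0 <= elev u a b c.
Proof.
move=> ab cb tb; rewrite ler_pdivrMr ?subr_gt0// mulrAC ler_pdivlMr ?subr_gt0//.
rewrite -subr_ge0 [X in 0 <= X](_ : _ = (t - dotp a u) * elev u a b c).
  by rewrite pmulr_rge0 ?subr_gt0.
by rewrite /elev; ring.
Qed.

Let slope_left_eq u t a b c : dotp a u < dotp b u -> dotp c u < dotp b u ->
  elev u a b c = 0 ->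
  (cross u c * (dotp b u - t) + cross u b * (t - dotp c u)) / (dotp b u - dotp c u)
  = (cross u a * (dotp b u - t) + cross u b * (t - dotp a u)) / (dotp b u - dotp a u).
Proof.
move=> ab cb e0.
have d1 : dotp b u - dotp a u != 0 by rewrite subr_eq0 gt_eqF.
have d2 : dotp b u - dotp c u != 0 by rewrite subr_eq0 gt_eqF.
apply/eqP; rewrite eqr_div// -subr_eq0 [X in X == 0](_ : _ = (dotp b u - t) * elev u a b c).
  by rewrite e0 mulr0.
by rewrite /elev; ring.
Qed.

Let slope_right_eq u t a b c : dotp a u < dotp b u -> dotp a u < dotp c u ->
  elev u a b c = 0 ->
  (cross u a * (dotp c u - t) + cross u c * (t - dotp a u)) / (dotp c u - dotp a u)
  = (cross u a * (dotp b u - t) + cross u b * (t - dotp a u)) / (dotp b u - dotp a u).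
Proof.
move=> ab cb e0.
have d1 : dotp b u - dotp a u != 0 by rewrite subr_eq0 gt_eqF.
have d2 : dotp c u - dotp a u != 0 by rewrite subr_eq0 gt_eqF.
apply/eqP; rewrite eqr_div// -subr_eq0 [X in X == 0](_ : _ = (t - dotp a u) * elev u a b c).
  by rewrite e0 mulr0.
by rewrite /elev; ring.
Qed.

(* Among the segments joining points of [s] across the level [t], a lowest one
   of maximal length is an edge of the lower hull. *)
Lemma rising_edge_exists u s t x y : u != 0 -> x \in s -> y \in s ->
  t \notin [seq dotp c u | c <- s] -> dotp x u < t < dotp y u ->
  exists e, [/\ e.1 \in s, e.2 \in s, hull_edge s e.1 e.2 &
                dotp e.1 u < t < dotp e.2 u].
Proof.
move=> u0 xs ys ts xty.
pose h (e : (R * R) * (R * R)) := (cross u e.1 * (dotp e.2 u - t) +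
  cross u e.2 * (t - dotp e.1 u)) / (dotp e.2 u - dotp e.1 u).
pose C := [seq e <- [seq (a, b) | a <- s, b <- s] | dotp e.1 u < t < dotp e.2 u].
have CP a b : ((a, b) \in C) = [&& a \in s, b \in s & dotp a u < t < dotp b u].
  rewrite mem_filter/= andbC; apply/andP/and3P => [[/allpairsP[[a' b'] /=]]|].
    by case=> a's b's [-> ->].
  by case=> as_ bs ab; split=> //; apply/allpairsP; exists (a, b).
have [e0 e0C e0min] : exists2 e, e \in C & forall z, z \in C -> h e <= h z.
  by apply: (exists_min_seq h C (x, y)); rewrite CP xs ys.
(* Collinear points give ties in height; the longest tied segment is taken because [hull_edge]
   allows no point of the line beyond its ends. *)
pose C' := [seq e <- C | h e == h e0].
have [[a b] eC' emax] : exists2 e, e \in C' &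
    forall z, z \in C' -> dotp e.1 u - dotp e.2 u <= dotp z.1 u - dotp z.2 u.
  apply: (exists_min_seq (fun e => dotp e.1 u - dotp e.2 u) C' e0).
  by rewrite mem_filter eqxx.
move: eC'; rewrite mem_filter CP => /andP[/eqP hab /and3P[as_ bs /andP[at_ tb]]].
have ab := lt_trans at_ tb.
exists (a, b); split; rewrite ?at_ ?tb//=.
rewrite (rising_edge_spec u)//; apply/allP => c cs.
have ct : dotp c u != t by apply: contraNneq ts => <-; exact: map_f.
have ge0 : 0 <= elev u a b c.
  (* Replacing the end on the same side of [t] by [c] gives another competitor, which is not lower
     at [t]. *)
  move: ct; rewrite neq_lt => /orP[ct|tc].
    apply: (slope_left u t) => //; first exact: lt_trans tb.
    rewrite -/(h (a, b)) -/(h (c, b)) hab; apply: e0min.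
    by rewrite CP cs bs ct tb.
  apply: (slope_right u t) => //; first exact: lt_trans tc.
  rewrite -/(h (a, b)) -/(h (a, c)) hab; apply: e0min.
  by rewrite CP cs as_ at_ tc.
rewrite ge0/=; apply/implyP => /eqP e0'.
move: ct; rewrite neq_lt => /orP[ct|tc].
  have cb := lt_trans ct tb; rewrite (ltW cb) andbT.
  have : (c, b) \in C'.
    rewrite mem_filter CP cs bs ct tb !andbT.
    by rewrite -hab /h/= (slope_left_eq u t a b c).
  by move=> /emax/=; rewrite lerD2r.
have ac := lt_trans at_ tc; rewrite (ltW ac)/=.
have : (a, c) \in C'.
  rewrite mem_filter CP cs as_ at_ tc !andbT.
  by rewrite -hab /h/= (slope_right_eq u t a b c).
by move=> /emax/=; rewrite lerD2l lerN2.
Qed.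

Let point_eq u v w : u != 0 -> dotp v u = dotp w u -> cross u v = cross u w ->
  v = w.
Proof.
move=> u0 e1 e2; apply/eqP; rewrite -subr_eq0 -dotp_eq0.
have /mulfI I : dotp u u != 0 by rewrite dotp_eq0.
apply/eqP/I; rewrite mulr0.
transitivity ((dotp v u - dotp w u) ^+ 2 + (cross u v - cross u w) ^+ 2).
  by case: u v w {u0 e1 e2 I} => [u1 u2] [v1 v2] [w1 w2]; rewrite /dotp /cross /=; ring.
by rewrite e1 e2 !subrr expr0n addr0.
Qed.

(** At level [t] the height of each edge above the line of the other is a weighted mean of two
    values of [elev], nonnegative by the edge property. The two heights are opposite up to positive
    factors, so all four values vanish; the points are then collinear and each edge contains the
    ends of the other. *)
Lemma rising_edge_unique u s t a b a' b' : u != 0 ->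
  a \in s -> b \in s -> a' \in s -> b' \in s ->
  hull_edge s a b -> hull_edge s a' b' ->
  dotp a u < t < dotp b u -> dotp a' u < t < dotp b' u -> a = a' /\ b = b'.
Proof.
move=> u0 as_ bs a's b's e e' /andP[at_ tb] /andP[at' tb'].
have ab := lt_trans at_ tb; have ab' := lt_trans at' tb'.
move: e e'; rewrite !(rising_edge_spec u)// => /allP e /allP e'.
have /andP[ea /implyP ea'] := e _ a's; have /andP[eb /implyP eb'] := e _ b's.
have /andP[fa /implyP fa'] := e' _ as_; have /andP[fb /implyP fb'] := e' _ bs.
have i1 : (dotp b' u - t) * elev u a b a' + (t - dotp a' u) * elev u a b b' =
  - ((dotp b u - t) * elev u a' b' a + (t - dotp a u) * elev u a' b' b).
  by rewrite /elev; ring.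
have p1 : 0 < dotp b' u - t by rewrite subr_gt0.
have p2 : 0 < t - dotp a' u by rewrite subr_gt0.
have p3 : 0 < dotp b u - t by rewrite subr_gt0.
have p4 : 0 < t - dotp a u by rewrite subr_gt0.
have q1 := mulr_ge0 (ltW p1) ea; have q2 := mulr_ge0 (ltW p2) eb.
have q3 := mulr_ge0 (ltW p3) fa; have q4 := mulr_ge0 (ltW p4) fb.
have z (p x : R) : 0 < p -> p * x = 0 -> x = 0.
  by move=> p0 /eqP; rewrite mulf_eq0 (gt_eqF p0) => /eqP.
have za : elev u a b a' = 0 by apply: z p1 _; lra.
have zb : elev u a b b' = 0 by apply: z p2 _; lra.
have za' : elev u a' b' a = 0 by apply: z p3 _; lra.
have zb' : elev u a' b' b = 0 by apply: z p4 _; lra.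
rewrite za eqxx in ea'; rewrite zb eqxx in eb'.
rewrite za' eqxx in fa'; rewrite zb' eqxx in fb'.
have /andP[r1 r2] := ea' isT; have /andP[r3 r4] := eb' isT.
have /andP[r5 r6] := fa' isT; have /andP[r7 r8] := fb' isT.
have da : dotp a u = dotp a' u by apply/le_anti; rewrite r1 r5.
have db : dotp b u = dotp b' u by apply/le_anti; rewrite r8 r4.
have ab0 : dotp b u - dotp a u != 0 by rewrite subr_eq0 gt_eqF.
split; apply: (point_eq u) => //.
  apply/esym/eqP; rewrite -subr_eq0; apply/eqP/(mulfI ab0); rewrite mulr0.
  by rewrite -za /elev da; ring.
apply/esym/eqP; rewrite -subr_eq0; apply/eqP/(mulfI ab0); rewrite mulr0.
by rewrite -zb /elev db; ring.
Qed.

Lemma sum_rising_edges u s x y : u != 0 -> uniq s -> x \in s -> y \in s ->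
  (forall c, c \in s -> dotp x u <= dotp c u <= dotp y u) ->
  \sum_(a <- s) \sum_(b <- s | hull_edge s a b && (dotp a u < dotp b u))
    (dotp b u - dotp a u) = dotp y u - dotp x u.
Proof.
move=> u0 us xs ys xsy.
pose E := [seq (a, b) | a <- s, b <- s].
pose P (e : (R * R) * (R * R)) := hull_edge s e.1 e.2 && (dotp e.1 u < dotp e.2 u).
have uE : uniq E.
  by apply: allpairs_uniq => // -[a b] [a' b'] _ _ /=.
have EP a b : ((a, b) \in E) = (a \in s) && (b \in s).
  apply/allpairsP/andP => [[[a' b'] /= [? ?]] [-> ->]//|[? ?]]; by exists (a, b).
transitivity (\sum_(e <- E | P e) (dotp e.2 u - dotp e.1 u)).
  rewrite [RHS]big_mkcond /E big_allpairs_dep/=; apply: eq_bigr => a _.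
  by rewrite [LHS]big_mkcond.
apply: (sum_interval_lengths _ _ _ _ _ [seq dotp c u | c <- s]).
- exact: map_f.
- exact: map_f.
- by have /andP[] := xsy _ xs.
- by move=> _ /mapP[c cs ->]; exact: xsy.
- move=> [a b]; rewrite EP => /andP[as_ bs] /andP[_ /= ab].
  by split; [exact: map_f|exact: map_f|exact: ltW].
move=> t ts xty.
have [[a b] /= [as_ bs ab atb]] := rising_edge_exists u s t x y u0 xs ys ts xty.
have abE : (a, b) \in E by rewrite EP as_.
have [at_ tb] := andP atb.
rewrite big_mkcond (bigD1_seq (a, b))//= {1}/P/= ab (lt_trans at_ tb) atb.
rewrite big1_seq ?addr0// => -[a' b'] /andP[/= ne].
rewrite EP => /andP[a's b's]; case: ifP => // /andP[/= e' _].
case: (boolP (dotp a' u < t < dotp b' u)) => //= at'.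
have [aa' bb'] := rising_edge_unique u s t a b a' b' u0 as_ bs a's b's ab e' atb at'.
by rewrite aa' bb' eqxx in ne.
Qed.

Lemma sum_edges_abs u s x y : u != 0 -> uniq s -> x \in s -> y \in s ->
  (forall c, c \in s -> dotp x u <= dotp c u <= dotp y u) ->
  \sum_(a <- s) \sum_(b <- s | hull_edge s a b) `|dotp (vsub b a) u| =
  2 * (dotp y u - dotp x u).
Proof.
move=> u0 us xs ys xsy.
have dN c : dotp c (- u) = - dotp c u by rewrite /dotp/=; ring.
have := sum_rising_edges u s x y u0 us xs ys xsy.
(* Falling edges along [u] are the rising edges along [- u], and level edges contribute nothing. *)
have := sum_rising_edges (- u) s y x.
rewrite oppr_eq0 => /(_ u0 us ys xs) H1 H2.
rewrite (_ : 2 * _ = (dotp y u - dotp x u) + (dotp x (- u) - dotp y (- u))); last first.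
  by rewrite !dN; ring.
rewrite -H2 -H1; last by move=> c /xsy; rewrite !dN !lerN2 andbC.
rewrite -big_split/=; apply: eq_bigr => a _.
rewrite [X in X + _]big_mkcondr [X in _ + X]big_mkcondr/= -big_split/=.
apply: eq_bigr => b _; rewrite dotp_vsub !dN ltrN2.
case: (ltgtP (dotp a u) (dotp b u)) => h.
- by rewrite addr0 gtr0_norm// subr_gt0.
- by rewrite add0r ltr0_norm ?subr_lt0//; ring.
- by rewrite h subrr normr0 addr0.
Qed.

End convex_hull_edges.

(** * The perimeter of the hull of a walk *)

(** The waiting-time recursion of queueing theory. It tracks how far the running maximum of the
    partial sums of [x] exceeds their current value, one step at a time. *)
Fixpoint lindley {R : realType} (x : nat -> R) (n : nat) : R :=
  if n is m.+1 then Num.max 0 (lindley x m - x m) else 0.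

Lemma lindley_ge0 {R : realType} (x : nat -> R) n : 0 <= lindley x n.
Proof. by case: n => //= n; rewrite le_max lexx. Qed.

Lemma lindley_max {R : realType} (x : nat -> R) n :
  (forall k, (k <= n)%N ->
     \sum_(i < k) x i <= \sum_(i < n) x i + lindley x n) /\
  (exists2 k, (k <= n)%N & \sum_(i < k) x i = \sum_(i < n) x i + lindley x n).
Proof.
elim: n => [|n [ub [k kn kE]]].
  by split=> [k|]; [rewrite leqn0 => /eqP ->; rewrite addr0 | exists 0%N; rewrite ?addr0].
have e : \sum_(i < n.+1) x i + lindley x n.+1 =
    Num.max (\sum_(i < n.+1) x i) (\sum_(i < n) x i + lindley x n).
  by rewrite /= addr_maxr addr0 big_ord_recr/=; congr Num.max; ring.
rewrite e; split=> [j|].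
  rewrite leq_eqVlt => /predU1P[->|jn]; first by rewrite le_max lexx.
  by rewrite le_max ub ?orbT.
case: leP => h; last by exists n.+1.
by exists k => //; exact: leqW.
Qed.

(** With the steps in reverse order, the partial sum of length [n - k] is [S_n - S_k]; its excess
    over the final value [S_n] is [- S_k]. The depth of a walk below its start is thus again a
    Lindley recursion. *)
Lemma lindley_rev_max {R : realType} (x : nat -> R) n :
  (forall k, (k <= n)%N ->
     - \sum_(i < k) x i <= lindley (fun i => x (n - i.+1)%N) n) /\
  (exists2 k, (k <= n)%N &
     - \sum_(i < k) x i = lindley (fun i => x (n - i.+1)%N) n).
Proof.
set y := fun i => x (n - i.+1)%N.
have sum_rev k : (k <= n)%N ->
    \sum_(i < k) y i = \sum_(i < n) x i - \sum_(i < n - k) x i.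
  move=> kn; rewrite -!(big_mkord xpredT) [X in _ = X - _](big_cat_nat (n := (n - k)%N))//=;
    last exact: leq_subr.
  rewrite addrAC subrr add0r big_nat_rev/= big_nat; symmetry.
  rewrite -{1}[(n - k)%N]add0n big_addn big_nat subKn//.
  apply: eq_bigr => i /andP[_ ik]; rewrite /y; congr x; lia.
have [ub [k kn kE]] := lindley_max y n.
have S0 : \sum_(i < n) y i = \sum_(i < n) x i.
  by rewrite sum_rev// subnn big_ord0 subr0.
split=> [j jn|].
  have := ub (n - j)%N (leq_subr _ _).
  by rewrite S0 sum_rev ?leq_subr// subKn// lerD2l.
exists (n - k)%N; first exact: leq_subr.
by move: kE; rewrite S0 sum_rev// => /addrI.
Qed.

(* The polyhedral norm on the right approximates the Euclidean one from above
   and is exact in the direction of [x]; its excess for steep vectors is of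
   order [a * `|y|]. *)
Lemma sqrt_le_polyhedral {R : realType} (a x y : R) : 0 <= a <= 1 ->
  Num.sqrt (x ^+ 2 + y ^+ 2) <=
  (1 - a) * `|x| + a / 2 * `|y| + (`|a * x + y| + `|a * x - y|) / 2.
Proof.
move=> /andP[a0 a1].
(* [M] is the larger of [a |x|] and [|y|]. *)
set M := (X in _ <= _ + X).
have aM : a * `|x| <= M.
  rewrite /M ler_pdivlMr// -[in leLHS](ger0_norm a0) -normrM mulr_natr.
  have -> : `|a * x| *+ 2 = `|(a * x + y) + (a * x - y)|.
    by rewrite -normrMn; congr (`|_|); ring.
  exact: ler_normD.
have yM : `|y| <= M.
  rewrite /M ler_pdivlMr// mulr_natr.
  have -> : `|y| *+ 2 = `|(a * x + y) - (a * x - y)|.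
    by rewrite -normrMn; congr (`|_|); ring.
  exact: ler_normB.
rewrite -(real_normK (num_real x)) -(real_normK (num_real y)).
move: `|x| `|y| (normr_ge0 x) (normr_ge0 y) aM yM => X Y X0 Y0 aM yM.
have sqrt_le (t b : R) : 0 <= b -> t <= b ^+ 2 -> Num.sqrt t <= b.
  by move=> b0 /ler_wsqrtr; rewrite sqrtr_sqr ger0_norm.
(* For a flat vector, [sqrt (X^2 + Y^2) <= X + Y^2 / (2 X)] with [Y <= a X] gives [X + a Y / 2], and
   [M] supplies the missing [a X]. For a steep one, [M >= Y] is used and the squares are
   compared. *)
have [YaX|aXY] := leP Y (a * X).
  apply: (@le_trans _ _ (X + a / 2 * Y)); last by lra.
  apply: sqrt_le; first by nra.
  have : Y * Y <= a * X * Y by exact: ler_wpM2r.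
  have : 0 <= (a * Y) ^+ 2 by exact: sqr_ge0.
  nra.
apply: (@le_trans _ _ ((1 - a) * X + a / 2 * Y + Y)); last by lra.
apply: sqrt_le; first by nra.
have h1 : 0 <= (1 - a) * X by nra.
have h2 : 0 <= a * Y by nra.
have h3 : (a * X) * ((1 - a) * X) <= Y * ((1 - a) * X) by apply: ler_wpM2r => //; exact: ltW.
have h5 : (a * X) * (a * (a * X)) <= Y * (a * Y).
  by apply: ler_pM; rewrite ?mulr_ge0//; [exact: ltW|exact: ler_wpM2l (ltW aXY)].
have h6 : 0 <= (a * Y) ^+ 2 by exact: sqr_ge0.
have h7 : a * (a * X) * ((1 - a) * X) <= a * Y * ((1 - a) * X).
  by apply: ler_wpM2r => //; exact: ler_wpM2l (ltW aXY).
nra.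
Qed.

Section hull_length_bounds.
Context {d : measure_display} {T : measurableType d} {R : realType}.
Variable Z : nat -> T -> R * R.

Definition overshoot (u : R * R) (n : nat) (w : T) : R :=
  lindley (fun i => dotp (Z i w) u) n.

Definition undershoot (u : R * R) (n : nat) (w : T) : R :=
  lindley (fun i => dotp (Z (n - i.+1)%N w) u) n.

Lemma dotp_walk u n w : dotp (walk Z n w) u = \sum_(i < n) dotp (Z i w) u.
Proof. by rewrite /dotp /walk /= !mulr_suml -big_split. Qed.

Let mem_walk n w k : (k <= n)%N ->
  walk Z k w \in undup [seq walk Z k w | k <- iota 0 n.+1].
Proof. by move=> kn; rewrite mem_undup; apply/mapP; exists k; rewrite ?mem_iota ?ltnS. Qed.

Let walk_memP n w c : c \in undup [seq walk Z k w | k <- iota 0 n.+1] ->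
  exists2 k, (k <= n)%N & c = walk Z k w.
Proof.
by rewrite mem_undup => /mapP[k]; rewrite mem_iota ltnS => /andP[_ kn] ->; exists k.
Qed.

Definition edge_variation (u : R * R) (n : nat) (w : T) : R :=
  let s := [seq walk Z k w | k <- iota 0 n.+1] in
  \sum_(a <- undup s) \sum_(b <- undup s | hull_edge s a b) `|dotp (vsub b a) u|.

Lemma hull_edge_undup (s : seq (R * R)) a b :
  hull_edge (undup s) a b = hull_edge s a b.
Proof. by rewrite /hull_edge; congr (_ && _); apply: eq_all_r => c; rewrite mem_undup. Qed.

Let edge_variation_walk u n w x y : u != 0 -> (x <= n)%N -> (y <= n)%N ->
  (forall k, (k <= n)%N ->
    dotp (walk Z x w) u <= dotp (walk Z k w) u <= dotp (walk Z y w) u) ->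
  edge_variation u n w = 2 * (dotp (walk Z y w) u - dotp (walk Z x w) u).
Proof.
move=> u0 xn yn xy; set s := [seq walk Z k w | k <- iota 0 n.+1].
rewrite -(sum_edges_abs u (undup s))//;
  [|exact: undup_uniq|exact: mem_walk|exact: mem_walk|].
  by apply: eq_bigr => a _; apply: eq_bigl => b; rewrite hull_edge_undup.
by move=> c /walk_memP[k kn ->]; exact: xy.
Qed.

Lemma edge_variationE u n w : u != 0 -> edge_variation u n w =
  2 * (dotp (walk Z n w) u + overshoot u n w + undershoot u n w).
Proof.
move=> u0.
have /=[ub [y yn yE]] := lindley_max (fun i => dotp (Z i w) u) n.
have /=[lb [x xn xE]] := lindley_rev_max (fun i => dotp (Z i w) u) n.
rewrite (edge_variation_walk u n w x y)//.
  by rewrite !dotp_walk yE -[X in _ - X]opprK xE opprK.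
move=> k kn; rewrite !dotp_walk yE ub// andbT -[leLHS]opprK xE lerNl.
exact: lb.
Qed.

(** The form used for driftless directions: both extremes are measured from the start of the walk,
    so no end term [S_n . u] is left over. *)
Lemma edge_variation_undershoot u n w : u != 0 -> edge_variation u n w =
  2 * (undershoot u n w + undershoot (- u) n w).
Proof.
move=> u0.
have /=[lb [x xn xE]] := lindley_rev_max (fun i => dotp (Z i w) u) n.
have /=[lb' [y yn]] := lindley_rev_max (fun i => dotp (Z i w) (- u)) n.
have dN k : - \sum_(i < k) dotp (Z i w) (- u) = dotp (walk Z k w) u.
  by rewrite dotp_walk -sumrN; apply: eq_bigr => i _; rewrite /dotp/=; ring.
rewrite dN => yE.
rewrite (edge_variation_walk u n w x y)//; first by rewrite yE dotp_walk xE addrC.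
move=> k kn; apply/andP; split; last by rewrite yE -dN; exact: lb'.
by rewrite !dotp_walk -[leLHS]opprK xE lerNl; exact: lb.
Qed.

Lemma hull_length_ge e n w : dotp e e = 1 ->
  2 * dotp (walk Z n w) e <= hull_length Z n w.
Proof.
move=> e1; have e0 : e != 0 by rewrite -dotp_eq0 e1 oner_eq0.
apply: (@le_trans _ _ (edge_variation e n w)).
  by rewrite edge_variationE// ler_pM2l// -addrA lerDl addr_ge0// lindley_ge0.
apply: ler_sum => a _; apply: ler_sum => b _.
rewrite -sqrtr_sqr; apply: ler_wsqrtr; rewrite -[leRHS]mul1r -e1.
move: (vsub b a) => v; rewrite -subr_ge0.
rewrite [X in 0 <= X](_ : _ = cross e v ^+ 2) ?sqr_ge0//.
by rewrite /dotp /cross; ring.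
Qed.

(** Here [f = a e + e'] and [g = a e - e']. In the sum of their extents the end terms along [e']
    cancel and those along [e] add up to the share [a] withheld from [e], so the leading term is
    exactly [2 S_n . e]. The driftless direction appears only with the factor [a]. *)
Lemma hull_length_le (e e' f g : R * R) (a : R) n w :
  dotp e e = 1 -> 0 < a <= 1 -> e' = (- e.2, e.1) ->
  f = (a * e.1 - e.2, a * e.2 + e.1) -> g = (a * e.1 + e.2, a * e.2 - e.1) ->
  hull_length Z n w <= 2 * dotp (walk Z n w) e +
    (2 * (1 - a) * (overshoot e n w + undershoot e n w) +
     a * (undershoot e' n w + undershoot (- e') n w) +
     (overshoot f n w + undershoot f n w) + (overshoot g n w + undershoot g n w)).
Proof.
move=> ee /andP[a0 a1] e'E fE gE.
have nz u : 0 < dotp u u -> u != 0 by move=> u0; rewrite -dotp_eq0 gt_eqF.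
have e0 : e != 0 by apply: nz; rewrite ee.
have ee' : e.1 * e.1 + e.2 * e.2 = 1 by [].
have e'0 : e' != 0.
  by apply: nz; rewrite (_ : dotp _ _ = 1)// -ee' /dotp ?e'E ?fE ?gE/=; ring.
have f0 : f != 0.
  apply: nz; rewrite (_ : dotp _ _ = (a ^+ 2 + 1) * dotp e e).
    by rewrite ee mulr1 addr_gt0// exprn_gt0.
  by rewrite /dotp ?fE ?gE/=; ring.
have g0 : g != 0.
  apply: nz; rewrite (_ : dotp _ _ = (a ^+ 2 + 1) * dotp e e).
    by rewrite ee mulr1 addr_gt0// exprn_gt0.
  by rewrite /dotp ?fE ?gE/=; ring.
apply: (@le_trans _ _ ((1 - a) * edge_variation e n w + a / 2 * edge_variation e' n w
   + (edge_variation f n w + edge_variation g n w) / 2)); last first.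
  rewrite (edge_variation_undershoot e')// (edge_variationE e)//.
  rewrite (edge_variationE f)// (edge_variationE g)//.
  rewrite le_eqVlt; apply/orP; left; apply/eqP.
  have -> : dotp (walk Z n w) f = a * dotp (walk Z n w) e + dotp (walk Z n w) e'.
    by rewrite /dotp e'E ?fE ?gE/=; ring.
  have -> : dotp (walk Z n w) g = a * dotp (walk Z n w) e - dotp (walk Z n w) e'.
    by rewrite /dotp e'E ?fE ?gE/=; ring.
  by field.
rewrite /edge_variation -big_split/= mulr_suml !mulr_sumr -!big_split/=.
apply: ler_sum => p _.
rewrite -big_split/= mulr_suml !mulr_sumr -!big_split/=.
apply: ler_sum => q _; move: (vsub q p) => v.
have -> : enorm v = Num.sqrt (dotp v e ^+ 2 + dotp v e' ^+ 2).
  rewrite /enorm -[in LHS](mulr1 (dotp v v)) -[in LHS]ee; congr Num.sqrt.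
  by rewrite /dotp e'E/=; ring.
have -> : dotp v f = a * dotp v e + dotp v e' by rewrite /dotp e'E ?fE ?gE/=; ring.
have -> : dotp v g = a * dotp v e - dotp v e' by rewrite /dotp e'E ?fE ?gE/=; ring.
by apply: sqrt_le_polyhedral; rewrite (ltW a0).
Qed.

(** The common form of overshoots and undershoots: a Lindley recursion over distinct steps in some
    order. For independent steps with a common law the moment bounds do not depend on that order. *)
Definition excursion (V : R * R -> nat -> T -> R) := forall u n, exists2 r,
  {in gtn n &, injective r} &
  V u n = (fun w => lindley (fun i => dotp (Z (r i) w) u) n).

Lemma overshoot_excursion : excursion overshoot.
Proof. by move=> u n; exists id => // i j. Qed.

Lemma undershoot_excursion : excursion undershoot.
Proof.
move=> u n; exists (fun i => n - i.+1)%N => // i j; rewrite !inE; lia.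
Qed.

End hull_length_bounds.

(** * Square-integrable and independent random variables *)

Section square_integrable.
Context {d : measure_display} {T : measurableType d} {R : realType}.
Variable P : probability T R.
Implicit Types (f g : T -> R).

Definition rintegrable f := P.-integrable setT (EFin \o f).

Definition square_integrable f :=
  measurable_fun setT f /\ rintegrable (fun w => f w ^+ 2).

Lemma rintegrable_measurable f : rintegrable f -> measurable_fun setT f.
Proof. by move=> /measurable_int/measurable_EFinP. Qed.

Lemma rintegrable_cst (c : R) : rintegrable (fun=> c).
Proof. exact: finite_measure_integrable_cst. Qed.

Lemma rintegrableD f g : rintegrable f -> rintegrable g ->
  rintegrable (fun w => f w + g w).
Proof. by move=> ? ?; apply: (@integrableD _ _ _ _ _ measurableT (EFin \o f) (EFin \o g)). Qed.

Lemma rintegrableZ (c : R) f : rintegrable f -> rintegrable (fun w => c * f w).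
Proof. by move=> ?; apply: (@integrableZl _ _ _ _ _ measurableT c (EFin \o f)). Qed.

Lemma rintegrable_le f g : measurable_fun setT f -> rintegrable g ->
  (forall w, `|f w| <= g w) -> rintegrable f.
Proof.
move=> mf ig fg; apply: (le_integrable measurableT _ _ ig) => [|w _ /=].
  exact/measurable_EFinP.
by rewrite lee_fin (le_trans (fg w))// ler_norm.
Qed.

Lemma square_integrable_le f g : measurable_fun setT f -> square_integrable g ->
  (forall w, `|f w| <= `|g w|) -> square_integrable f.
Proof.
move=> mf [mg ig] fg; split => //; apply: rintegrable_le ig _.
  exact: measurable_funX.
move=> w; rewrite normrX -[leRHS]real_normK ?num_real//.
by rewrite lerXn2r ?nnegrE.
Qed.

Lemma square_integrable_mul f g : square_integrable f -> square_integrable g ->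
  rintegrable (fun w => f w * g w).
Proof.
move=> [mf if_] [mg ig].
apply: (rintegrable_le _ (fun w => f w ^+ 2 + g w ^+ 2)).
- exact: measurable_funM.
- exact: rintegrableD.
- move=> w; rewrite normrM -(real_normK (num_real (f w))) -(real_normK (num_real (g w))).
  by move: `|_| `|_| => x y; have := sqr_ge0 (x - y);
    have := sqr_ge0 x; have := sqr_ge0 y; nra.
Qed.

Lemma square_integrable_cst (c : R) : square_integrable (fun=> c).
Proof. by split; [exact: measurable_cst|exact: rintegrable_cst]. Qed.

Lemma square_integrableW f : square_integrable f -> rintegrable f.
Proof.
move=> f2; have := square_integrable_mul _ _ f2 (square_integrable_cst 1).
by congr rintegrable; apply/funext => w; rewrite mulr1.
Qed.

Lemma square_integrableD f g : square_integrable f -> square_integrable g ->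
  square_integrable (fun w => f w + g w).
Proof.
move=> f2 g2; split; first by apply: measurable_funD; [case: f2|case: g2].
have -> : (fun w => (f w + g w) ^+ 2) = (fun w => f w ^+ 2 + (2 * (f w * g w) + g w ^+ 2)).
  by apply/funext => w; ring.
apply: rintegrableD; first by case: f2.
apply: rintegrableD; last by case: g2.
exact/rintegrableZ/square_integrable_mul.
Qed.

Lemma square_integrableZ (c : R) f : square_integrable f ->
  square_integrable (fun w => c * f w).
Proof.
move=> [mf f2]; split; first exact: measurable_funM.
have -> : (fun w => (c * f w) ^+ 2) = (fun w => c ^+ 2 * f w ^+ 2).
  by apply/funext => w; rewrite exprMn.
exact: rintegrableZ.
Qed.

Lemma RintD f g : rintegrable f -> rintegrable g ->
  \int[P]_w (f w + g w) = \int[P]_w f w + \int[P]_w g w.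
Proof. exact: RintegralD. Qed.

Lemma RintZ (c : R) f : rintegrable f -> \int[P]_w (c * f w) = c * \int[P]_w f w.
Proof. exact: RintegralZl. Qed.

Lemma Rint_cst (c : R) : \int[P]_w c = c.
Proof. by rewrite Rintegral_cst// [X in fine X](@probability_setT _ _ _ P) mulr1. Qed.

Lemma Rint_le f g : rintegrable f -> rintegrable g -> (forall w, f w <= g w) ->
  \int[P]_w f w <= \int[P]_w g w.
Proof. by move=> ? ? fg; apply: le_Rintegral. Qed.

Lemma Rint_ge0 f : (forall w, 0 <= f w) -> 0 <= \int[P]_w f w.
Proof. by move=> f0; apply: Rintegral_ge0. Qed.

Lemma Rint_fineK f : rintegrable f -> (\int[P]_w f w)%:E = (\int[P]_w (f w)%:E)%E.
Proof. by move=> fi; rewrite /Rintegral fineK//; apply: integrable_fin_num. Qed.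

Lemma Rint_sqr_le f : square_integrable f ->
  (\int[P]_w f w) ^+ 2 <= \int[P]_w (f w ^+ 2).
Proof.
move=> f2; set m := \int[P]_w f w.
have fi := square_integrableW _ f2.
have : 0 <= \int[P]_w (f w ^+ 2 + (- (2 * m) * f w + m ^+ 2)).
  apply: Rint_ge0 => w.
  by rewrite [X in 0 <= X](_ : _ = (f w - m) ^+ 2) ?sqr_ge0//; ring.
have i1 : rintegrable (fun w => - (2 * m) * f w) by exact: rintegrableZ.
have i0 : rintegrable (fun=> m ^+ 2) by exact: rintegrable_cst.
have i2 : rintegrable (fun w => f w ^+ 2) by case: f2.
have i3 := rintegrableD _ _ i1 i0.
rewrite (RintD _ _ i2 i3) (RintD _ _ i1 i0) (RintZ _ _ fi) Rint_cst.
by rewrite -/m; nra.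
Qed.

Definition independent2 f g := forall A B : set R, measurable A -> measurable B ->
  (P (f @^-1` A `&` g @^-1` B) = P (f @^-1` A) * P (g @^-1` B))%E.

Lemma independent2_comp f g (h k : R -> R) : measurable_fun setT h ->
  measurable_fun setT k -> independent2 f g -> independent2 (h \o f) (k \o g).
Proof.
move=> mh mk fg A B mA mB; apply: (fg (h @^-1` A) (k @^-1` B)).
  by rewrite -[X in measurable X]setTI; exact: mh.
by rewrite -[X in measurable X]setTI; exact: mk.
Qed.

End square_integrable.

(** * Expectation of a product of two independent variables *)

Section independent_product.
Context {d : measure_display} {T : measurableType d} {R : realType}.
Variables (P : probability T R) (X Y : {mfun T >-> R}).
Hypothesis XY : independent2 P X Y.
Hypotheses (iX : rintegrable P X) (iY : rintegrable P Y).

Let mpair : measurable_fun setT (fun w => (X w, Y w)).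
Proof. exact/measurable_fun_pair. Qed.

Let joint : {mfun T >-> (R * R)%type} := mfun_Sub (mem_set mpair).

Let prod_law (A : set (R * R)) : measurable A ->
  (distribution P X \x distribution P Y)%E A = distribution P joint A.
Proof. by apply: product_measure_unique => A' B mA mB; rewrite -XY. Qed.

Let f (z : R * R) : \bar R := (z.1 * z.2)%:E.

Let mf : measurable_fun setT f.
Proof. by apply/measurable_EFinP; apply: measurable_funM. Qed.

(** By Tonelli the integral of [|x y|] under the product law is [E|X| E|Y|]. *)
Let finf : (distribution P X \x distribution P Y)%E.-integrable setT f.
Proof.
apply/(integrable12ltyP _ _ mf).
have nX : measurable_fun setT (fun x : R => `|x|%:E).
  by apply/measurable_EFinP; exact: normr_measurable.
have /= nYfin : (\int[P]_w (`|Y w|)%:E < +oo)%E by have /integrableP[_] := iY.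
have nXfin : (\int[P]_w (`|X w|)%:E < +oo)%E by have /integrableP[_] := iX.
pose c := fine (\int[P]_w (`|Y w|)%:E)%E.
have cE : (\int[P]_w (`|Y w|)%:E)%E = c%:E.
  by rewrite fineK// ge0_fin_numE// integral_ge0.
under eq_integral => x _.
  under eq_integral => y _ do rewrite /f/= normrM EFinM.
  rewrite ge0_integralZl//.
  rewrite (ge0_integral_distribution Y nX)//= cE; over.
rewrite ge0_integralZr//; last by rewrite lee_fin -lee_fin -cE integral_ge0.
rewrite (ge0_integral_distribution X nX)//=.
rewrite lte_mul_pinfty ?ltry//; first exact: integral_ge0.
by rewrite ge0_fin_numE// integral_ge0.
Qed.

Let integrable_joint : P.-integrable setT (f \o joint).
Proof.
apply/integrableP; split; first exact: measurableT_comp.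
have mabs : measurable_fun setT (fun z => `|f z|)%E by exact: measurableT_comp.
rewrite -(ge0_integral_distribution joint mabs)//.
rewrite -(eq_measure_integral _ (fun A mA _ => prod_law A mA)).
by have /integrableP[_] := finf.
Qed.

Lemma independent2_rintegrable : rintegrable P (fun w => X w * Y w).
Proof. exact: integrable_joint. Qed.

Lemma independent2_Rint : \int[P]_w (X w * Y w) = \int[P]_w X w * \int[P]_w Y w.
Proof.
rewrite {1}/Rintegral.
rewrite -[X in fine X](@integral_distribution _ _ _ _ _ P joint f mf)//.
rewrite -(eq_measure_integral _ (fun A mA _ => prod_law A mA)).
rewrite -integral12_prod_meas1//.
have idY : (distribution P Y).-integrable setT (fun y : R => y%:E).
  apply: (@integrable_pushforward _ _ _ _ _ Y (measurable_funPT Y) P) => //.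
  exact/measurable_EFinP.
have idX : (distribution P X).-integrable setT (fun y : R => y%:E).
  apply: (@integrable_pushforward _ _ _ _ _ X (measurable_funPT X) P) => //.
  exact/measurable_EFinP.
have EX (V : {mfun T >-> R}) : rintegrable P V ->
    (\int[distribution P V]_y y%:E)%E = (\int[P]_w V w)%:E.
  move=> iV; rewrite Rint_fineK//.
  have mE : measurable_fun [set: R] (fun y : R => y%:E) by exact/measurable_EFinP.
  exact: (@integral_distribution _ _ _ _ _ P V _ mE iV).
under eq_integral => x _.
  rewrite /fubini_F; under eq_integral => y _ do rewrite /f/= EFinM.
  rewrite integralZl// EX//; over.
by rewrite integralZr// EX.
Qed.

End independent_product.

Lemma independent2_integral {d : measure_display} {T : measurableType d}
    {R : realType} (P : probability T R) (f g : T -> R) :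
  independent2 P f g -> rintegrable P f -> rintegrable P g ->
  rintegrable P (fun w => f w * g w) /\
  \int[P]_w (f w * g w) = \int[P]_w f w * \int[P]_w g w.
Proof.
move=> fg if_ ig.
pose X : {mfun T >-> R} := mfun_Sub (mem_set (rintegrable_measurable P f if_)).
pose Y : {mfun T >-> R} := mfun_Sub (mem_set (rintegrable_measurable P g ig)).
split; first exact: (independent2_rintegrable P X Y fg).
exact: (independent2_Rint P X Y fg).
Qed.

(** * Independence of a step from the past of the walk *)

Section independence.
Context {d : measure_display} {T : measurableType d} {R : realType}.
Variables (P : probability T R) (Z : nat -> T -> R * R).
Hypothesis mZ : forall i, measurable_fun setT (Z i).
Hypothesis indZ : mutually_independent P Z.

(** A family closed under intersection that generates the sigma-algebra of the steps indexed by [s];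
    on it, independence is the product formula assumed of [Z]. *)
Definition cylinders (s : seq nat) : set (set T) :=
  [set A | exists2 B : nat -> set (R * R), (forall i, measurable (B i)) &
             A = \bigcap_(i in [set i | i \in s]) (Z i @^-1` B i)].

Let mpre i (B : set (R * R)) : measurable B -> measurable (Z i @^-1` B).
Proof. by move=> mB; rewrite -[X in measurable X]setTI; exact: mZ. Qed.

Let cylinders_measurable s : cylinders s `<=` measurable.
Proof.
move=> _ [B mB ->]; apply: fin_bigcap_measurable; first exact: finite_seq.
by move=> i _; exact: mpre.
Qed.

Let cylinders_setI s : setI_closed (cylinders s).
Proof.
move=> _ _ [B mB ->] [C mC ->]; exists (fun i => B i `&` C i).
  by move=> i; exact: measurableI.
by rewrite -bigcapI; apply: eq_bigcapr => i _; rewrite preimage_setI.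
Qed.

Let cylinders_setT s : cylinders s setT.
Proof.
by exists (fun=> setT) => //; apply/seteqP; split.
Qed.

Let cylinder_indep s j (A : set T) (B : set (R * R)) : uniq s -> j \notin s ->
  measurable B -> cylinders s A ->
  (P (A `&` Z j @^-1` B) = P A * P (Z j @^-1` B))%E.
Proof.
move=> us js mB [C mC ->].
pose D i := if i == j then B else C i.
have mD i : measurable (D i) by rewrite /D; case: ifP.
have Ds i : i \in s -> D i = C i.
  by move=> si; rewrite /D; case: eqP => // ij; rewrite -ij si in js.
have Dj : D j = B by rewrite /D eqxx.
have := indZ (j :: s); rewrite /= js us => /(_ isT D mD).
rewrite big_cons Dj muleC.
have -> : \bigcap_(i in [set i | i \in j :: s]) Z i @^-1` D i =
    \bigcap_(i in [set i | i \in s]) Z i @^-1` C i `&` Z j @^-1` B.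
  apply/seteqP; split=> w /=.
    move=> h; split; last by have := h j (mem_head _ _); rewrite /= Dj.
    by move=> i /= si; have := h i; rewrite /= inE si orbT Ds//; exact.
  move=> [h1 h2] i /=; rewrite inE => /predU1P[->|si]; first by rewrite Dj.
  by rewrite Ds//; exact: h1.
move=> ->; congr (_ * _)%E.
rewrite (indZ _ us _ mC) big_seq [RHS]big_seq.
by apply: eq_bigr => i si; rewrite Ds.
Qed.

(** As functions of [A], both sides are finite measures that agree on the cylinders, hence on the
    sigma-algebra they generate. *)
Let sigma_indep s j (A : set T) (B : set (R * R)) : uniq s -> j \notin s ->
  measurable B -> <<s cylinders s>> A ->
  (P (A `&` Z j @^-1` B) = P A * P (Z j @^-1` B))%E.
Proof.
move=> us js mB sA; have mZB := mpre j B mB.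
pose r := fine (P (Z j @^-1` B)).
have rE : P (Z j @^-1` B) = r%:E by rewrite fineK// fin_num_measure.
have r0 : 0 <= r by rewrite fine_ge0.
suff H : mrestr P mZB A = mscale (NngNum r0) P A by rewrite rE muleC; exact: H.
apply: (g_sigma_algebra_measure_unique (cylinders s) (@cylinders_measurable s)
  (fun=> setT) _ _ _ _
  (@cylinders_setI s)) => //.
- by rewrite bigcup_const//; exists 0%N.
- move=> C GC; transitivity (P C * r%:E)%E; last by rewrite muleC.
  by rewrite -rE; exact: (cylinder_indep s j C B us js mB GC).
- by move=> _; rewrite /= /mrestr setTI rE ltry.
Qed.

(** Dependence on the steps in [s] alone is expressed by changing the measurable structure of the
    domain, so that the usual closure properties of measurable functions apply. *)
Definition past_measurable s (f : T -> R) :=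
  measurable_fun [set: g_sigma_algebraType (cylinders s)]
    (f : g_sigma_algebraType (cylinders s) -> R).

Lemma past_measurable_step s i (h : R * R -> R) : i \in s ->
  measurable_fun setT h -> past_measurable s (fun w => h (Z i w)).
Proof.
move=> si mh _ A mA; rewrite setTI.
have mhA : measurable (h @^-1` A) by rewrite -[X in measurable X]setTI; exact: mh.
apply: sub_sigma_algebra; exists (fun k => if k == i then h @^-1` A else setT).
  by move=> k; case: ifP.
apply/seteqP; split=> w /= => [hA k /= _|/(_ i si)/=]; last by rewrite eqxx.
by case: eqP => [->|].
Qed.

Lemma past_measurable_independent s j (f : T -> R) (h : R * R -> R) :
  uniq s -> j \notin s -> past_measurable s f -> measurable_fun setT h ->
  independent2 P f (fun w => h (Z j w)).
Proof.
move=> us js mf mh A B mA mB.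
apply: (@sigma_indep s j _ (h @^-1` B)) => //.
  by rewrite -[X in measurable X]setTI; exact: mh.
have : measurable ([set: g_sigma_algebraType (cylinders s)] `&` f @^-1` A) by exact: mf.
by rewrite setTI.
Qed.

End independence.

(** The measurable structure is arbitrary: the lemma serves both for [T] and for the sigma-algebra
    of the past. *)
Lemma measurable_fun_lindley {d : measure_display} {T : measurableType d}
    {R : realType} (x : nat -> T -> R) n :
  (forall i, (i < n)%N -> measurable_fun setT (x i)) ->
  measurable_fun setT (fun w => lindley (x ^~ w) n).
Proof.
elim: n => [_|n IH mx] /=; first exact: measurable_cst.
apply: measurable_maxr; first exact: measurable_cst.
by apply: measurable_funB; [apply: IH => i /ltnW; exact: mx|exact: mx].
Qed.

Lemma measurable_fun_dotp {R : realType} (u : R * R) :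
  measurable_fun setT (fun z : R * R => dotp z u).
Proof.
by apply: measurable_funD; apply: measurable_funM => //; exact: measurable_cst.
Qed.

(** * Second moments of Lindley recursions *)

Lemma measurable_fun_gt_indicator {R : realType} (t : R) :
  measurable_fun setT (fun x : R => (t < x)%R%:R : R).
Proof.
rewrite (_ : (fun x => _) = \1_(`]t, +oo[%classic)); first exact: measurable_indic.
by apply/funext => x; rewrite indicE mem_setE in_itv/= andbT.
Qed.

Section lindley_moments.
Context {d : measure_display} {T : measurableType d} {R : realType}.
Variables (P : probability T R) (x : nat -> T -> R) (c m : R).
Hypotheses (c0 : 0 <= c) (m0 : 0 <= m).
Local Notation D k := (fun w => lindley (x ^~ w) k).

Definition lindley_step k := [/\ square_integrable P (x k),
  independent2 P (D k) (x k), c <= \int[P]_w x k w &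
  \int[P]_w (x k w ^+ 2) <= m].

Lemma square_integrable_lindley n : (forall k, (k < n)%N -> lindley_step k) ->
  square_integrable P (D n).
Proof.
elim: n => [_|n IH steps]; first exact: square_integrable_cst.
have Dn := IH (fun k kn => steps k (ltnW kn)).
have [xn _ _ _] := steps n (ltnSn n).
apply: (square_integrable_le _ _ (fun w => lindley (x ^~ w) n + (-1) * x n w)).
- apply: measurable_fun_lindley => i ni; by have [[]] := steps i ni.
- exact/square_integrableD/square_integrableZ.
- move=> w; rewrite mulN1r [leLHS]/=.
  by case: (leP 0 (lindley (x ^~ w) n - x n w)) => h; rewrite ?normr0.
Qed.

(** Dropping the maximum gives [D'^2 <= (D - x)^2], and independence factors the cross term into
    [E D] times [E x]. Keeping that term yields two bounds at once: on [E D^2], and for positive [c]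
    on the sum of the [E D_k]. *)
Lemma lindley_second_moment n : (forall k, (k < n)%N -> lindley_step k) ->
  \int[P]_w (lindley (x ^~ w) n ^+ 2) +
    2 * c * \sum_(k < n) \int[P]_w lindley (x ^~ w) k <= n%:R * m.
Proof.
elim: n => [_|n IH steps].
  rewrite big_ord0 mulr0 mul0r addr0 (_ : (fun w => _) = fun=> 0) ?Rint_cst//.
  by apply/funext => w; rewrite /= expr0n.
have steps' k (kn : (k < n)%N) := steps k (ltnW kn).
have {}IH := IH steps'; have Dn := square_integrable_lindley _ steps'.
have Dn1 := square_integrable_lindley _ steps.
have [xn ind cx xm] := steps n (ltnSn n).
have Di := square_integrableW _ _ Dn; have xi := square_integrableW _ _ xn.
have [iDx EDx] := independent2_integral P _ _ ind Di xi.
have D2 : rintegrable P (fun w => lindley (x ^~ w) n ^+ 2) by case: Dn.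
have D12 : rintegrable P (fun w => lindley (x ^~ w) n.+1 ^+ 2) by case: Dn1.
have x2 : rintegrable P (fun w => x n w ^+ 2) by case: xn.
have i1 := rintegrableZ P (- 2) _ iDx.
have i2 := rintegrableD P _ _ i1 x2.
have i3 := rintegrableD P _ _ D2 i2.
have := Rint_le P _ _ D12 i3.
rewrite (RintD P _ _ D2 i2) (RintD P _ _ i1 x2) (RintZ P _ _ iDx) EDx.
have ED : 0 <= \int[P]_w lindley (x ^~ w) n by apply: Rint_ge0 => w; exact: lindley_ge0.
have cD : c * \int[P]_w lindley (x ^~ w) n <=
    \int[P]_w lindley (x ^~ w) n * \int[P]_w x n w by rewrite mulrC ler_wpM2l.
have pointwise w : lindley (x ^~ w) n.+1 ^+ 2 <= lindley (x ^~ w) n ^+ 2 +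
    (- 2 * (lindley (x ^~ w) n * x n w) + x n w ^+ 2).
  rewrite /=; move: (lindley _ n) (x n w) => a b.
  rewrite [leRHS](_ : _ = (a - b) ^+ 2); last by ring.
  by case: (leP 0 (a - b)) => // _; rewrite expr0n sqr_ge0.
move=> /(_ pointwise) le1; rewrite big_ord_recr/= -natr1.
by rewrite /= in le1; lra.
Qed.

(** The squared excess of [D] over [2 t] can grow only when [D > t] or a step exceeds [t] in size.
    The first event is rare on average, by Markov and the bound on the sum of the [E D_k]; the
    second is paid for by [eta]. *)
Lemma lindley_second_moment_tail n (t eta : R) : 0 < c -> 0 < t ->
  (forall k, (k < n)%N -> lindley_step k) ->
  (forall k, (k < n)%N -> \int[P]_w (x k w ^+ 2 * (t < `|x k w|)%R%:R) <= eta) ->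
  \int[P]_w (lindley (x ^~ w) n ^+ 2) <=
    8 * t ^+ 2 + n%:R * (2 * eta + m ^+ 2 / (c * t)).
Proof.
move=> cp tp steps tails.
pose g k w := Num.max 0 (lindley (x ^~ w) k - 2 * t).
have g2 k : (k <= n)%N -> square_integrable P (g k).
  move=> kn; have Dk := square_integrable_lindley k (fun j jk => steps j (leq_trans jk kn)).
  apply: (square_integrable_le _ _ _ _ Dk).
    apply: measurable_maxr; first exact: measurable_cst.
    by apply: measurable_funB => //; case: Dk.
  move=> w; have D0 := lindley_ge0 (x ^~ w) k; rewrite /g (ger0_norm D0).
  case: (leP 0 (lindley (x ^~ w) k - 2 * t)) => h; last by rewrite normr0.
  by rewrite ger0_norm//; lra.
have key k : (k <= n)%N -> \int[P]_w (g k w ^+ 2) <=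
    k%:R * eta + m / t * \sum_(j < k) \int[P]_w lindley (x ^~ w) j.
  elim: k => [_|k IH kn].
    rewrite big_ord0 mulr0 mul0r addr0 (_ : (fun w => _) = fun=> 0) ?Rint_cst//.
    by apply/funext => w; rewrite /g /= max_l ?expr0n//; lra.
  have {}IH := IH (ltnW kn).
  have Dk := square_integrable_lindley k (fun j jk => steps j (ltn_trans jk kn)).
  have [xk ind cx xm] := steps k kn.
  have Di := square_integrableW _ _ Dk; have xi := square_integrableW _ _ xk.
  have gk := g2 k (ltnW kn); have gi := square_integrableW _ _ gk.
  have [mx x2] := xk; have [mD _] := Dk.
  have mpos : measurable_fun setT (fun y : R => Num.max 0 (y - 2 * t)).
    by apply: measurable_maxr => //; exact: measurable_funB.
  have indg : independent2 P (g k) (x k).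
    exact: (independent2_comp P _ _ _ _ mpos (@measurable_id _ _ _) ind).
  have [igx Egx] := independent2_integral P _ _ indg gi xi.
  pose a w : R := (t < lindley (x ^~ w) k)%R%:R.
  pose b w : R := (t < `|x k w|)%R%:R.
  have ma : measurable_fun setT a.
    exact: measurableT_comp (measurable_fun_gt_indicator t) mD.
  have mb : measurable_fun setT b.
    apply: (measurableT_comp (measurable_fun_gt_indicator t)).
    exact: measurableT_comp.
  have ia : rintegrable P a.
    apply: (rintegrable_le P _ _ ma (rintegrable_cst P 1)) => w.
    by rewrite /a; case: (_ < _); rewrite ?normr1 ?normr0.
  have msq : measurable_fun setT (fun y : R => y ^+ 2) by exact: measurable_funX.
  have indax : independent2 P a (fun w => x k w ^+ 2).
    exact: (independent2_comp P _ _ _ _ (measurable_fun_gt_indicator t) msq ind).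
  have [iax Eax] := independent2_integral P _ _ indax ia x2.
  have ixb : rintegrable P (fun w => x k w ^+ 2 * b w).
    apply: (rintegrable_le P _ _ _ x2).
      by apply: measurable_funM => //; exact: measurable_funX.
    move=> w; rewrite /b normrM ger0_norm ?sqr_ge0//.
    by case: (_ < _); rewrite ?normr1 ?normr0 ?mulr1// mulr0 sqr_ge0.
  have [_ gi2] := gk; have [_ g1i2] := g2 k.+1 kn.
  have i1 := rintegrableD P _ _ iax ixb.
  have i2 := rintegrableZ P (- 2) _ igx.
  have i3 := rintegrableD P _ _ i2 i1.
  have i4 := rintegrableD P _ _ gi2 i3.
  (* If [D <= t], then [g k] vanishes and [g k.+1] is positive only after a step below [- t]: the
     threshold [2 t] leaves room for one step of size [t]. *)
  have pointwise w : g k.+1 w ^+ 2 <= g k w ^+ 2 + (- 2 * (g k w * x k w) +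
      (a w * x k w ^+ 2 + x k w ^+ 2 * b w)).
    rewrite /g /a /b /=; have := lindley_ge0 (x ^~ w) k.
    move: (lindley _ k) (x k w) => y z y0.
    set G := Num.max 0 (y - 2 * t).
    have -> : Num.max 0 (Num.max 0 (y - z) - 2 * t) = Num.max 0 (y - z - 2 * t).
      case: (leP 0 (y - z)) => // h; rewrite !max_l//; lra.
    have rhs0 : (t < y)%R -> 0 <= G ^+ 2 + (- 2 * (G * z) + z ^+ 2).
      by move=> _; rewrite [X in 0 <= X](_ : _ = (G - z) ^+ 2) ?sqr_ge0//; ring.
    have zb : 0 <= z ^+ 2 * ((t < `|z|)%R%:R : R) by rewrite mulr_ge0 ?sqr_ge0 ?ler0n.
    have G0 : y <= t -> G = 0 by move=> yt; rewrite /G max_l//; lra.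
    have [h|h] := leP (y - z - 2 * t) 0.
      rewrite expr0n; case: ltP => /= [/rhs0|/G0 ->]; lra.
    case: ltP => /= [ty|yt].
      have [h2|h2] := leP (y - 2 * t) 0.
        by rewrite /G max_l//; nra.
      by rewrite /G max_r ?(ltW h2)//; lra.
    rewrite G0//; have zt : z < - t by lra.
    rewrite ltr0_norm; last by lra.
    by have -> : (t < - z) = true; [lra|rewrite mulr1; nra].
  have := Rint_le P _ _ g1i2 i4 pointwise.
  rewrite (RintD P _ _ gi2 i3) (RintD P _ _ i2 i1) (RintD P _ _ iax ixb).
  rewrite (RintZ P _ _ igx) Egx Eax => le1.
  have g0 : 0 <= \int[P]_w g k w by apply: Rint_ge0 => w; rewrite /g le_max lexx.
  have gx : 0 <= \int[P]_w g k w * \int[P]_w x k w.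
    by rewrite mulr_ge0// (le_trans c0).
  have tb : \int[P]_w (x k w ^+ 2 * b w) <= eta := tails k kn.
  (* Markov's inequality for the event [D > t]. *)
  have aD : \int[P]_w a w <= t^-1 * \int[P]_w lindley (x ^~ w) k.
    rewrite -(RintZ P _ _ Di); apply: Rint_le => //; first exact: rintegrableZ.
    move=> w; rewrite /a; have D0 := lindley_ge0 (x ^~ w) k.
    case: ltP => h /=; last by rewrite mulr_ge0// invr_ge0 ltW.
    by rewrite mulrC ler_pdivlMr// mul1r ltW.
  have a0 : 0 <= \int[P]_w a w by apply: Rint_ge0 => w; rewrite /a ler0n.
  have am : \int[P]_w a w * \int[P]_w (x k w ^+ 2) <=
      m / t * \int[P]_w lindley (x ^~ w) k.
    rewrite -mulrA mulrC; apply: ler_pM => //.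
    by apply: Rint_ge0 => w; exact: sqr_ge0.
  apply: le_trans le1 _; rewrite big_ord_recr/= -natr1.
  by lra.
have [gn gn2] := g2 n (leqnn n).
have [Dn Dn2] := square_integrable_lindley n steps.
(* From [D <= 2 t + g] follows [D^2 <= 8 t^2 + 2 g^2]. *)
have i1 := rintegrableD P _ _ (rintegrable_cst P (8 * t ^+ 2)) (rintegrableZ P 2 _ gn2).
have := Rint_le P _ _ Dn2 i1.
rewrite (RintD P _ _ (rintegrable_cst P _) (rintegrableZ P 2 _ gn2)) Rint_cst.
rewrite (RintZ P _ _ gn2) => le1.
apply: le_trans (le1 _) _.
  move=> w; rewrite /g; have := lindley_ge0 (x ^~ w) n.
  move: (lindley _ n) => y y0; case: (leP 0 (y - 2 * t)) => h; last first.
    have : y * y <= (2 * t) * (2 * t) by apply: ler_pM; lra.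
    by rewrite expr0n /= mulr0; have := sqr_ge0 t; lra.
  by have := sqr_ge0 (y - 4 * t); nra.
rewrite lerD2l; have kn := key n (leqnn n).
have s2 := lindley_second_moment n steps.
set S := \sum_(j < n) _ in kn s2.
have e0 : 0 <= \int[P]_w (lindley (x ^~ w) n ^+ 2).
  by apply: Rint_ge0 => w; exact: sqr_ge0.
have : 2 * (m / t * S) <= n%:R * (m ^+ 2 / (c * t)).
  have -> : 2 * (m / t * S) = (m / (c * t)) * (2 * c * S).
    by field; rewrite !gt_eqF.
  have -> : n%:R * (m ^+ 2 / (c * t)) = (m / (c * t)) * (n%:R * m).
    by field; rewrite !gt_eqF.
  apply: ler_wpM2l; last by lra.
  by rewrite divr_ge0// mulr_ge0// ltW.
rewrite mulrDr; lra.
Qed.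

End lindley_moments.

(** * Random walks *)

(** Dominated convergence along integer thresholds, then monotonicity in the threshold. *)
Lemma uniform_integrability_tail {d : measure_display} {T : measurableType d}
    {R : realType} (P : probability T R) (Q : T -> R) (eps : R) :
  rintegrable P Q -> (forall w, 0 <= Q w) -> 0 < eps ->
  exists t0 : R, forall t, t0 <= t -> \int[P]_w (Q w * (t < Q w)%R%:R) <= eps.
Proof.
move=> iQ Q0 eps0; have mQ := rintegrable_measurable P Q iQ.
pose f (t : R) w := Q w * (t < Q w)%R%:R.
have mf t : measurable_fun setT (f t).
  apply: measurable_funM => //.
  exact: measurableT_comp (measurable_fun_gt_indicator t) mQ.
have fQ t w : `|f t w| <= Q w.
  rewrite /f normrM ger0_norm//.
  by case: (_ < _); rewrite ?normr1 ?mulr1// normr0 mulr0.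
have if_ t : rintegrable P (f t) by exact: rintegrable_le iQ (fQ t).
have [_ _ cvg0] : [/\ P.-integrable setT (cst 0 : T -> \bar R),
    (\int[P]_w (`|(f n%:R w)%:E - cst 0 w|))%E @[n --> \oo] --> 0%E &
    (\int[P]_w (f n%:R w)%:E)%E @[n --> \oo] --> (\int[P]_w (cst 0 w : \bar R))%E].
  apply: (@dominated_convergence _ _ _ P setT measurableT
    (fun n w => (f n%:R w)%:E) (cst 0) (EFin \o Q)) => //.
  - by move=> n; exact/measurable_EFinP.
  - apply: aeW => w _; apply: cvg_near_cst; near=> n; congr EFin.
    rewrite /f ltNge (_ : Q w <= n%:R) ?mulr0//.
    by near: n; exact: nbhs_infty_ger.
  - by apply: aeW => w n _; rewrite lee_fin.
have eps_nbhs : nbhs (\int[P]_w (cst 0 w : \bar R))%E [set y | (y < eps%:E)%E].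
  apply: open_nbhs_nbhs; split; first exact: open_ereal_lt_ereal.
  by rewrite /= integral0 lte_fin.
have [N _ /(_ N (leqnn N)) /= HN] := cvg0 _ eps_nbhs.
exists N%:R => t Nt; have : \int[P]_w f N%:R w <= eps.
  by rewrite -lee_fin Rint_fineK// ltW.
apply: le_trans; apply: Rint_le; [exact: if_|exact: if_|move=> w].
rewrite /f ler_wpM2l// ler_nat.
by case: (ltP t (Q w)) => // /(le_lt_trans Nt) ->.
Unshelve. all: by end_near. Qed.

Lemma sqrD_le {R : realType} (x y : R) : (x + y) ^+ 2 <= 2 * x ^+ 2 + 2 * y ^+ 2.
Proof. by have := sqr_ge0 (x - y); lra. Qed.

Lemma dotp_cauchy_schwarz {R : realType} (u v : R * R) :
  dotp u v ^+ 2 <= dotp u u * dotp v v.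
Proof.
rewrite -subr_ge0 [X in 0 <= X](_ : _ = cross u v ^+ 2) ?sqr_ge0//.
by rewrite /dotp /cross; ring.
Qed.

Section random_walk.
Context {d : measure_display} {T : measurableType d} {R : realType}.
Variables (P : probability T R) (Z : nat -> T -> R * R).
Hypothesis mZ : forall i, measurable_fun setT (Z i).
Hypothesis indZ : mutually_independent P Z.
Hypothesis iddZ : identically_distributed P Z.
Hypothesis Z2 : rintegrable P (fun w => dotp (Z 0 w) (Z 0 w)).

Lemma identically_distributed_Rint i (h : R * R -> R) : measurable_fun setT h ->
  rintegrable P (fun w => h (Z 0 w)) ->
  rintegrable P (fun w => h (Z i w)) /\
  \int[P]_w h (Z i w) = \int[P]_w h (Z 0 w).
Proof.
move=> mh ih0.
have mh' : measurable_fun setT (fun z => (h z)%:E) by exact/measurable_EFinP.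
have law (A : set (R * R)) : measurable A -> pushforward P (Z 0) A = pushforward P (Z i) A.
  by move=> mA; exact/esym/iddZ.
have ih : rintegrable P (fun w => h (Z i w)).
  apply/integrableP; split; first exact: (measurableT_comp mh' (mZ i)).
  have mabs : measurable_fun setT (fun z => `|(h z)%:E|)%E by exact: measurableT_comp.
  rewrite -(@ge0_integral_pushforward _ _ _ _ _ _ (mZ i) P setT (fun z => `|(h z)%:E|)%E)//.
  rewrite -(eq_measure_integral _ (fun A mA _ => law A mA)).
  rewrite ge0_integral_pushforward//.
  by have /integrableP[_] := ih0.
  exact: mZ.
split=> //; congr fine.
rewrite -[LHS](@integral_pushforward _ _ _ _ _ _ (mZ i) P setT _ mh' ih)//.
rewrite -[RHS](@integral_pushforward _ _ _ _ _ _ (mZ 0) P setT _ mh' ih0)//.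
exact/esym/(eq_measure_integral _ (fun A mA _ => law A mA)).
Qed.

End random_walk.

Section random_walk_excursions.
Context {d : measure_display} {T : measurableType d} {R : realType}.
Variables (P : probability T R) (Z : nat -> T -> R * R).
Hypothesis mZ : forall i, measurable_fun setT (Z i).
Hypothesis indZ : mutually_independent P Z.
Hypothesis iddZ : identically_distributed P Z.
Hypothesis Z2 : rintegrable P (fun w => dotp (Z 0 w) (Z 0 w)).

Lemma square_integrable_step i u : square_integrable P (fun w => dotp (Z i w) u).
Proof.
have m1 j : measurable_fun setT (fun w => dotp (Z j w) u).
  exact: measurableT_comp (measurable_fun_dotp u) (mZ j).
split=> //; have msq : measurable_fun setT (fun z => dotp z u ^+ 2).
  by apply: measurable_funX; exact: measurable_fun_dotp.
apply: (identically_distributed_Rint P Z mZ iddZ i _ msq _).1.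
apply: (rintegrable_le P _ _ _ (rintegrableZ P (dotp u u) _ Z2)).
  exact: measurable_funX.
by move=> w; rewrite ger0_norm ?sqr_ge0// mulrC dotp_cauchy_schwarz.
Qed.

Lemma Rint_step i u :
  \int[P]_w dotp (Z i w) u = \int[P]_w dotp (Z 0 w) u.
Proof.
apply: (identically_distributed_Rint P Z mZ iddZ i _ (measurable_fun_dotp u) _).2.
exact/square_integrableW/square_integrable_step.
Qed.

Lemma past_measurable_lindley (r : nat -> nat) u n :
  past_measurable Z [seq r i | i <- iota 0 n]
    (fun w => lindley (fun i => dotp (Z (r i) w) u) n).
Proof.
apply: (@measurable_fun_lindley _ (g_sigma_algebraType
  (cylinders Z [seq r i | i <- iota 0 n])) R (fun i w => dotp (Z (r i) w) u)).
move=> i ni; apply: (past_measurable_step Z _ (r i) _ _ (measurable_fun_dotp u)).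
by apply: map_f; rewrite mem_iota.
Qed.

(** The recursion at time [k] depends only on the steps [r 0], ..., [r (k - 1)], and injectivity
    keeps [r k] outside this set. *)
Lemma walk_lindley_step (r : nat -> nat) u n c m :
  {in gtn n &, injective r} ->
  c <= \int[P]_w dotp (Z 0 w) u -> \int[P]_w (dotp (Z 0 w) u ^+ 2) <= m ->
  forall k, (k < n)%N -> lindley_step P (fun i w => dotp (Z (r i) w) u) c m k.
Proof.
move=> rinj cu um k kn; split.
- exact: square_integrable_step.
- have us : uniq [seq r i | i <- iota 0 k].
    rewrite map_inj_in_uniq ?iota_uniq// => i j; rewrite !mem_iota !add0n => /= ik jk.
    by apply: rinj; rewrite inE; [exact: ltn_trans kn|exact: ltn_trans kn].
  have rk : r k \notin [seq r i | i <- iota 0 k].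
    apply/mapP => -[i]; rewrite mem_iota add0n => /= ik /esym/rinj.
    by rewrite !inE => /(_ (ltn_trans ik kn) kn) ik'; rewrite ik' ltnn in ik.
  exact: (past_measurable_independent P Z mZ indZ _ _ _ _ us rk
    (past_measurable_lindley r u k) (measurable_fun_dotp u)).
- by rewrite Rint_step.
- have msq : measurable_fun setT (fun z => dotp z u ^+ 2).
    by apply: measurable_funX; exact: measurable_fun_dotp.
  by rewrite (identically_distributed_Rint P Z mZ iddZ (r k) _ msq _).2//;
    have [] := square_integrable_step 0 u.
Qed.

(** The factor 2 bounds [dotp u u] for every direction in use, since [a e + e'] and [a e - e'] have
    squared length [1 + a^2]. One [m] and one [tail] thus serve all directions. *)
Let m := \int[P]_w (2 * dotp (Z 0 w) (Z 0 w)).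

Let tail t := \int[P]_w (2 * dotp (Z 0 w) (Z 0 w) *
  (t < 2 * dotp (Z 0 w) (Z 0 w))%R%:R).

Let m_ge0 : 0 <= m.
Proof. by apply: Rint_ge0 => w; rewrite mulr_ge0// dotp_ge0. Qed.

Let step_le u (z : R * R) : dotp u u <= 2 -> dotp z u ^+ 2 <= 2 * dotp z z.
Proof.
move=> u2; apply: le_trans (dotp_cauchy_schwarz _ _) _.
by rewrite mulrC ler_wpM2r// dotp_ge0.
Qed.

Let step_second_moment u : dotp u u <= 2 -> \int[P]_w (dotp (Z 0 w) u ^+ 2) <= m.
Proof.
move=> u2; apply: Rint_le; last by move=> w; exact: step_le.
  by have [] := square_integrable_step 0 u.
exact: rintegrableZ.
Qed.

Let step_tail i u t : dotp u u <= 2 -> 0 <= t ->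
  \int[P]_w (dotp (Z i w) u ^+ 2 * (t < `|dotp (Z i w) u|)%R%:R) <= tail (t ^+ 2).
Proof.
move=> u2 t0.
have mi : measurable_fun setT (fun z : R * R => dotp z u ^+ 2 * (t < `|dotp z u|)%R%:R).
  apply: measurable_funM; first by apply: measurable_funX; exact: measurable_fun_dotp.
  apply: (measurableT_comp (measurable_fun_gt_indicator t)).
  by apply: measurableT_comp => //; exact: measurable_fun_dotp.
have mz : measurable_fun setT (fun w => 2 * dotp (Z 0 w) (Z 0 w)).
  exact: (rintegrable_measurable P _ (rintegrableZ P 2 _ Z2)).
have [_ iu] := square_integrable_step 0 u.
have i0 : rintegrable P (fun w => dotp (Z 0 w) u ^+ 2 * (t < `|dotp (Z 0 w) u|)%R%:R).
  apply: (rintegrable_le P _ _ (measurableT_comp mi (mZ 0)) iu) => w.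
  rewrite /= ger0_norm; last by rewrite mulr_ge0 ?sqr_ge0 ?ler0n.
  by case: (_ < _); rewrite ?mulr1// mulr0 sqr_ge0.
rewrite (identically_distributed_Rint P Z mZ iddZ i _ mi i0).2.
apply: Rint_le => // [|w].
  apply: (rintegrable_le P _ _ _ (rintegrableZ P 2 _ Z2)).
    apply: measurable_funM => //.
    exact: measurableT_comp (measurable_fun_gt_indicator _) mz.
  move=> w; have h : 0 <= 2 * dotp (Z 0 w) (Z 0 w) by rewrite mulr_ge0// dotp_ge0.
  rewrite ger0_norm; last by rewrite mulr_ge0 ?ler0n.
  by case: (_ < _); rewrite ?mulr1// mulr0.
have := step_le u (Z 0 w) u2; move: (dotp _ u) (2 * _) => x y xy.
have y0 : 0 <= y by exact: le_trans (sqr_ge0 _) xy.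
case: ltP => /= tx; last by rewrite mulr0 mulr_ge0 ?ler0n.
have -> : (t ^+ 2 < y) = true.
  apply: lt_le_trans xy; rewrite -[X in _ < X]real_normK ?num_real//.
  by rewrite ltrXn2r ?nnegrE.
by rewrite !mulr1.
Qed.

Lemma excursion_second_moment V u n : excursion Z V -> dotp u u <= 2 ->
  0 <= \int[P]_w dotp (Z 0 w) u ->
  square_integrable P (V u n) /\ \int[P]_w (V u n w ^+ 2) <= n%:R * m.
Proof.
move=> /(_ u n)[r rinj ->] u2 u0.
have steps := walk_lindley_step r u n 0 m rinj u0 (step_second_moment u u2).
split; first exact: (square_integrable_lindley _ _ _ _ _ steps).
have := lindley_second_moment P _ 0 m n steps.
by rewrite mulr0 mul0r addr0.
Qed.

Lemma excursion_second_moment_drift V u n c t : excursion Z V -> dotp u u <= 2 ->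
  0 < c -> 0 < t -> c <= \int[P]_w dotp (Z 0 w) u ->
  square_integrable P (V u n) /\
  \int[P]_w (V u n w ^+ 2) <=
    8 * t ^+ 2 + n%:R * (2 * tail (t ^+ 2) + m ^+ 2 / (c * t)).
Proof.
move=> /(_ u n)[r rinj ->] u2 c0 t0 cu.
have steps := walk_lindley_step r u n c m rinj cu (step_second_moment u u2).
split; first exact: (square_integrable_lindley _ _ _ _ _ steps).
apply: (lindley_second_moment_tail P _ c m (ltW c0) m_ge0 n t _ c0 t0 steps) => k kn.
exact/step_tail/ltW.
Qed.

Lemma walk_variance u n : let nu := \int[P]_w dotp (Z 0 w) u in
  let xi i w := dotp (Z i w) u - nu in
  square_integrable P (fun w => \sum_(i < n) xi i w) /\
  \int[P]_w (\sum_(i < n) xi i w) = 0 /\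
  \int[P]_w ((\sum_(i < n) xi i w) ^+ 2) = n%:R * \int[P]_w (xi 0%N w ^+ 2).
Proof.
move=> nu xi.
have xi2 i : square_integrable P (xi i).
  exact: (square_integrableD P _ _ (square_integrable_step i u)
    (square_integrable_cst P (- nu))).
have xi_i i := square_integrableW P _ (xi2 i).
have mh : measurable_fun setT (fun z : R * R => dotp z u - nu).
  by apply: measurable_funB => //; exact: measurable_fun_dotp.
have mh2 : measurable_fun setT (fun z : R * R => (dotp z u - nu) ^+ 2).
  exact: measurable_funX.
have xi0 i : \int[P]_w xi i w = 0.
  have si := square_integrableW P _ (square_integrable_step i u).
  by rewrite /xi (RintD P _ _ si (rintegrable_cst P (- nu))) Rint_cst Rint_step subrr.
have xiE i : \int[P]_w (xi i w ^+ 2) = \int[P]_w (xi 0%N w ^+ 2).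
  by apply: (identically_distributed_Rint P Z mZ iddZ i _ mh2 _).2; have [] := xi2 0%N.
elim: n => [|n [S2 [S0 SE]]].
  rewrite (_ : (fun w => \sum_(i < 0) xi i w) = fun=> 0); last first.
    by apply/funext => w; rewrite big_ord0.
  rewrite mul0r (_ : (fun w => (\sum_(i < 0) xi i w) ^+ 2) = fun=> 0); last first.
    by apply/funext => w; rewrite big_ord0 expr0n.
  by rewrite !Rint_cst; split=> //; exact: square_integrable_cst.
have recE : (fun w => \sum_(i < n.+1) xi i w) = fun w => \sum_(i < n) xi i w + xi n w.
  by apply/funext => w; rewrite big_ord_recr.
have ind : independent2 P (fun w => \sum_(i < n) xi i w) (xi n).
  apply: (past_measurable_independent P Z mZ indZ (iota 0 n) n
    _ (fun z => dotp z u - nu)) => //; first exact: iota_uniq.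
    by rewrite mem_iota add0n ltnn.
  apply: (@measurable_sum _ (g_sigma_algebraType (cylinders Z (iota 0 n))) R setT
    'I_n _ (fun i w => xi i w)) => i.
  by apply: (past_measurable_step Z (iota 0 n) i _ _ mh); rewrite mem_iota add0n /=.
have Si := square_integrableW P _ S2.
have [iSx ESx] := independent2_integral P _ _ ind Si (xi_i n).
split; first by rewrite recE; exact: square_integrableD.
split; first by rewrite recE (RintD P _ _ Si (xi_i n)) S0 xi0 addr0.
rewrite (_ : (fun w => (\sum_(i < n.+1) xi i w) ^+ 2) = fun w =>
    (\sum_(i < n) xi i w) ^+ 2 +
    (2 * ((\sum_(i < n) xi i w) * xi n w) + xi n w ^+ 2)); last first.
  apply/funext => w; rewrite big_ord_recr [X in (_ + X) ^+ 2]/=.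
  by move: (\sum_(i < n) _) (xi n w) => a b; ring.
have [_ S2i] := S2; have [_ x2i] := xi2 n; have i1 := rintegrableZ P 2 _ iSx.
rewrite (RintD P _ _ S2i (rintegrableD P _ _ i1 x2i)) (RintD P _ _ i1 x2i).
by rewrite (RintZ P _ _ iSx) ESx S0 SE xiE mul0r mulr0 add0r -natr1 mulrDl mul1r.
Qed.

End random_walk_excursions.

(** * Variance of the perimeter *)

(* Unlike [ge0_le_integral], no measurability is required: the integral of a
   nonnegative function is a supremum over the simple functions below it. *)
Lemma ge0_integral_mono {d : measure_display} {T : measurableType d}
    {R : realType} (mu : {measure set T -> \bar R}) (f g : T -> \bar R) :
  (forall x, 0 <= f x)%E -> (forall x, f x <= g x)%E ->
  (\int[mu]_x f x <= \int[mu]_x g x)%E.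
Proof.
move=> f0 fg; have g0 x : (0 <= g x)%E by exact: le_trans (f0 x) (fg x).
rewrite !ge0_integralTE//; apply: le_ereal_sup => _ [h /= hf <-].
by exists h => // x; exact: le_trans (hf x) (fg x).
Qed.

(** The mean of [L] lies between [b] and [b + E F], so [L - E L] differs from [Y] by at most
    [F + E F]. The parameter [del] balances the cross term, and the factor 4 comes from
    [(F + E F)^2 <= 2 F^2 + 2 (E F)^2]. *)
Lemma variance_sandwich {d : measure_display} {T : measurableType d}
    {R : realType} (P : probability T R) (L Y F : T -> R) (b del H : R) :
  0 < del -> 0 <= b -> square_integrable P Y -> square_integrable P F ->
  \int[P]_w Y w = 0 -> (forall w, 0 <= L w) ->
  (forall w, b + Y w <= L w) -> (forall w, L w <= b + Y w + F w) ->
  H = del * \int[P]_w (Y w ^+ 2) + (1 + del^-1) * (4 * \int[P]_w (F w ^+ 2)) ->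
  ((\int[P]_w (Y w ^+ 2) - H)%:E <= 'V_P[L] <= (\int[P]_w (Y w ^+ 2) + H)%:E)%E.
Proof.
move=> del0 b0 Y2 F2 EY L0 LY LF HE.
have Yi := square_integrableW P _ Y2; have Fi := square_integrableW P _ F2.
have F0 w : 0 <= F w by have := LY w; have := LF w; lra.
set EF := \int[P]_w F w.
have EF0 : 0 <= EF by exact: Rint_ge0.
have bY := rintegrableD P _ _ (rintegrable_cst P b) Yi.
have EbY : \int[P]_w (b + Y w) = b.
  by rewrite (RintD P _ _ (rintegrable_cst P b) Yi) Rint_cst EY addr0.
have bYF := rintegrableD P _ _ bY Fi.
have Lub : ('E_P[L] <= (b + EF)%:E)%E.
  rewrite unlock -EbY /EF -(RintD P _ _ bY Fi) Rint_fineK//.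
  by apply: ge0_integral_mono => w; rewrite lee_fin.
have Llb : (b%:E <= 'E_P[L])%E.
  (* [b + Y] may be negative; its positive part still lies below [L], and [ge0_integral_mono]
     applies to it. *)
  have mp : measurable_fun setT (fun w => Num.max 0 (b + Y w)).
    by apply: measurable_maxr => //; exact: rintegrable_measurable bY.
  have ip : rintegrable P (fun w => Num.max 0 (b + Y w)).
    apply: (square_integrableW P).
    apply: (square_integrable_le _ _ _ mp
      (square_integrableD P _ _ (square_integrable_cst P b) Y2)).
    by move=> w; case: (leP 0 (b + Y w)) => //; rewrite normr0.
  apply: (@le_trans _ _ (\int[P]_w Num.max 0 (b + Y w))%:E).
    rewrite lee_fin -{1}EbY; apply: Rint_le => // w.
    by rewrite le_max lexx orbT.
  rewrite unlock Rint_fineK//; apply: ge0_integral_mono => w; rewrite lee_fin.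
    by rewrite le_max lexx.
  by rewrite ge_max L0 LY.
have [l lE] : exists l, ('E_P[L] = l%:E)%E.
  exists (fine 'E_P[L]%E); rewrite fineK// fin_numE.
  by rewrite gt_eqF ?(lt_le_trans (ltNyr b))//= lt_eqF// (le_lt_trans Lub)// ltry.
rewrite lE !lee_fin in Lub Llb.
have -> : ('V_P[L] = \int[P]_w ((L w - l) ^+ 2)%:E)%E.
  by rewrite /variance [in LHS]unlock lE [in LHS]unlock.
pose G w := F w + EF.
have G2 : square_integrable P G by exact: square_integrableD (square_integrable_cst P _).
pose h w := del * Y w ^+ 2 + (1 + del^-1) * G w ^+ 2.
have [_ Y2i] := Y2; have [_ G2i] := G2; have [_ F2i] := F2.
have hi : rintegrable P h by exact/rintegrableD/rintegrableZ/G2i/rintegrableZ.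
have EG : \int[P]_w (G w ^+ 2) <= 4 * \int[P]_w (F w ^+ 2).
  have i1 := rintegrableZ P 2 _ F2i; have i2 := rintegrable_cst P (2 * EF ^+ 2).
  apply: (@le_trans _ _ (\int[P]_w (2 * F w ^+ 2 + 2 * EF ^+ 2))).
    by apply: Rint_le => //; [exact: rintegrableD|move=> w; exact: sqrD_le].
  rewrite (RintD P _ _ i1 i2) (RintZ P _ _ F2i) Rint_cst.
  by have := Rint_sqr_le P _ F2; rewrite -/EF; lra.
have Eh : \int[P]_w h w <= H.
  rewrite (RintD P _ _ (rintegrableZ P _ _ Y2i) (rintegrableZ P _ _ G2i)).
  rewrite (RintZ P _ _ Y2i) (RintZ P _ _ G2i) HE lerD2l ler_wpM2l//.
  by rewrite addr_ge0// invr_ge0 ltW.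
(* With [r] the deviation of [L - l] from [Y], use [2 |Y r| <= del Y^2 + r^2 / del]. *)
have dev w : `|(L w - l) ^+ 2 - Y w ^+ 2| <= h w.
  have rG : - G w <= L w - l - Y w <= G w.
    by rewrite /G; have := LY w; have := LF w; have := F0 w; lra.
  have -> : (L w - l) ^+ 2 - Y w ^+ 2 =
      2 * Y w * (L w - l - Y w) + (L w - l - Y w) ^+ 2 by ring.
  rewrite /h; move: (G w) (Y w) (L w - l - Y w) rG => g y r rg.
  have dV0 : 0 < del^-1 by rewrite invr_gt0.
  have r2 : r ^+ 2 <= g ^+ 2.
    by case/andP: rg => ? ?; rewrite -subr_ge0 subr_sqr mulr_ge0//; lra.
  have dr2 : del^-1 * r ^+ 2 <= del^-1 * g ^+ 2 by rewrite ler_pM2l.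
  have sq (z : R) : 0 <= del * y ^+ 2 - 2 * y * z + del^-1 * z ^+ 2.
    rewrite [X in 0 <= X](_ : _ = del^-1 * (del * y - z) ^+ 2).
      by rewrite mulr_ge0 ?sqr_ge0// ltW.
    by field; rewrite gt_eqF.
  have := sq r; have := sq (- r); have := sqr_ge0 r; rewrite sqrrN => ? ? ?.
  by rewrite ler_norml; apply/andP; split; lra.
apply/andP; split.
  (* The positive part again, for the same reason. *)
  pose k w := Num.max 0 (Y w ^+ 2 - h w).
  have i1 := rintegrableD P _ _ Y2i (rintegrableZ P (-1) _ hi).
  have ki : rintegrable P k.
    apply: (rintegrable_le P _ _ _ Y2i).
      apply: measurable_maxr => //.
      by apply: measurable_funB;
        [exact: (rintegrable_measurable P _ Y2i)|exact: (rintegrable_measurable P _ hi)].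
    move=> w; have hw : 0 <= h w by exact: le_trans (dev w).
    rewrite ger0_norm ?le_max ?lexx// ge_max sqr_ge0/=; lra.
  apply: (@le_trans _ _ (\int[P]_w k w)%:E).
    rewrite lee_fin; apply: (@le_trans _ _ (\int[P]_w (Y w ^+ 2 + (-1) * h w))).
      rewrite (RintD P _ _ Y2i (rintegrableZ P (-1) _ hi)) (RintZ P _ _ hi).
      by lra.
    by apply: Rint_le => // w; rewrite mulN1r le_max lexx orbT.
  rewrite Rint_fineK//; apply: ge0_integral_mono => w; rewrite lee_fin.
    by rewrite le_max lexx.
  by rewrite ge_max sqr_ge0/=; have := dev w; rewrite ler_norml; lra.
apply: (@le_trans _ _ (\int[P]_w (Y w ^+ 2 + h w))%:E).
  rewrite Rint_fineK; last exact: rintegrableD.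
  apply: ge0_integral_mono => w; rewrite lee_fin ?sqr_ge0//.
  by have := dev w; rewrite ler_norml; lra.
by rewrite lee_fin (RintD P _ _ Y2i hi) lerD2l.
Qed.

(** A factor 4 for the four groups and 2 for each pair, with [2 (1 - a)] bounded by 2. The second
    group must keep its [a^2], which makes the driftless terms small. *)
Lemma sqr_weighted_sum_le {R : realType} (a x1 x2 x3 x4 x5 x6 x7 x8 : R) :
  0 <= a <= 1 ->
  (2 * (1 - a) * (x1 + x2) + a * (x3 + x4) + (x5 + x6) + (x7 + x8)) ^+ 2 <=
  32 * (x1 ^+ 2 + x2 ^+ 2) + 8 * a ^+ 2 * (x3 ^+ 2 + x4 ^+ 2) +
  8 * (x5 ^+ 2 + x6 ^+ 2) + 8 * (x7 ^+ 2 + x8 ^+ 2).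
Proof.
move=> /andP[a0 a1].
have h (x y : R) : (x + y) ^+ 2 <= 2 * (x ^+ 2 + y ^+ 2) by rewrite mulrDr sqrD_le.
have h4 (p q r s : R) : (p + q + r + s) ^+ 2 <= 4 * (p ^+ 2 + q ^+ 2 + r ^+ 2 + s ^+ 2).
  by have := h (p + q + r) s; have := sqrD_le (p + q) (r + s); have := h p q;
    have := h r s; rewrite -addrA; lra.
apply: le_trans (h4 _ _ _ _) _.
have := h x5 x6; have := h x7 x8.
have e1 : (2 * (1 - a) * (x1 + x2)) ^+ 2 <= 8 * (x1 ^+ 2 + x2 ^+ 2).
  have : (1 - a) ^+ 2 * (x1 + x2) ^+ 2 <= 1 * (x1 + x2) ^+ 2.
    by apply: ler_wpM2r; rewrite ?sqr_ge0// expr_le1//; lra.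
  by have := h x1 x2; rewrite !exprMn; lra.
have e2 : (a * (x3 + x4)) ^+ 2 <= 2 * a ^+ 2 * (x3 ^+ 2 + x4 ^+ 2).
  have : a ^+ 2 * (x3 + x4) ^+ 2 <= a ^+ 2 * (2 * (x3 ^+ 2 + x4 ^+ 2)).
    by apply: ler_wpM2l; rewrite ?sqr_ge0.
  by rewrite exprMn; lra.
lra.
Qed.

(** The parameters depend on one another in order: [a] makes the driftless terms small, this fixes
    the drift [c = a nu] of [f] and [g], then [t] and finally [n] are taken large. Two thirds of
    [eps] go to the six drifted terms and one third to the two driftless ones. *)
Lemma hull_length_approx {d : measure_display} {T : measurableType d}
    {R : realType} (P : probability T R) (Z : nat -> T -> R * R)
    (e : R * R) (nu eps : R) :
  (forall i, measurable_fun setT (Z i)) -> mutually_independent P Z ->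
  identically_distributed P Z -> rintegrable P (fun w => dotp (Z 0 w) (Z 0 w)) ->
  dotp e e = 1 -> 0 < nu ->
  (forall u, \int[P]_w dotp (Z 0 w) u = nu * dotp e u) -> 0 < eps ->
  exists N, forall n, (N <= n)%N -> exists F, [/\ square_integrable P F,
    forall w, 2 * dotp (walk Z n w) e <= hull_length Z n w,
    forall w, hull_length Z n w <= 2 * dotp (walk Z n w) e + F w &
    \int[P]_w (F w ^+ 2) <= eps * n%:R].
Proof.
move=> mZ indZ iddZ Z2 ee nu0 drift eps0.
have Qi : rintegrable P (fun w => 2 * dotp (Z 0 w) (Z 0 w)) by exact: rintegrableZ.
have Q0 w : 0 <= 2 * dotp (Z 0 w) (Z 0 w) by rewrite mulr_ge0// dotp_ge0.
set m := \int[P]_w (2 * dotp (Z 0 w) (Z 0 w)).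
have m0 : 0 <= m by exact: Rint_ge0.
(* Any [a] in [(0, 1]] with [48 a m <= eps] would do. *)
pose a := eps / (48 * m + eps).
have den0 : 0 < 48 * m + eps by lra.
have a0 : 0 < a by exact: divr_gt0.
have a1 : a <= 1 by rewrite ler_pdivrMr// mul1r; lra.
have am : 48 * (a * m) <= eps.
  have : a * (48 * m + eps) = eps by rewrite divfK// gt_eqF.
  by have := mulr_ge0 (ltW a0) (ltW eps0); lra.
clearbody a.
pose c := a * nu; have c0 : 0 < c by exact: mulr_gt0.
have cE : c = a * nu by [].
clearbody c.
have eps1 : 0 < eps / 576 by lra.
have [t0 tail_le] := uniform_integrability_tail P _ _ Qi Q0 eps1.
(* [1 <= t] gives [t0 <= t^2], the threshold met by squared steps; the last entry makes
   [96 m^2 / (c t)] at most [eps / 6]. *)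
pose t := Num.max 1 (Num.max t0 (576 * m ^+ 2 / (c * eps))).
have t1 : 1 <= t by rewrite le_max lexx.
have tt0 : t0 <= t by rewrite !le_max lexx orbT.
have tc : 576 * m ^+ 2 / (c * eps) <= t by rewrite !le_max lexx !orbT.
have tpos : 0 < t by exact: lt_le_trans t1.
clearbody t.
have tail2 : \int[P]_w (2 * dotp (Z 0 w) (Z 0 w) *
    (t ^+ 2 < 2 * dotp (Z 0 w) (Z 0 w))%R%:R) <= eps / 576.
  by apply: tail_le; apply: le_trans tt0 _; rewrite expr2 ler_peMr// ltW.
have mct : 96 * (m ^+ 2 / (c * t)) <= eps / 6.
  rewrite mulrA ler_pdivrMr ?mulr_gt0//.
  move: tc; rewrite ler_pdivrMr ?mulr_gt0//; lra.
(* [4608 = 6 * 768] and [768 = 96 * 8]: the constant term [8 t^2] of the drifted bound, with total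
   weight 96, stays below [n eps / 6]. *)
exists (Num.truncn (4608 * t ^+ 2 / eps)).+1 => n Nn.
have nt : 768 * t ^+ 2 <= n%:R * (eps / 6).
  have : 4608 * t ^+ 2 / eps <= n%:R.
    by apply: le_trans (ltW (truncnS_gt _)) _; rewrite ler_nat.
  by rewrite ler_pdivrMr//; lra.
pose e' : R * R := (- e.2, e.1).
pose f : R * R := (a * e.1 - e.2, a * e.2 + e.1).
pose g : R * R := (a * e.1 + e.2, a * e.2 - e.1).
have e'2 : dotp e' e' <= 2.
  have -> : dotp e' e' = dotp e e by rewrite /dotp/=; ring.
  by rewrite ee ler1n.
have Ne'2 : dotp (- e') (- e') <= 2.
  have -> : dotp (- e') (- e') = dotp e e by rewrite /dotp/=; ring.
  by rewrite ee ler1n.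
have a2 : a ^+ 2 <= 1 by rewrite expr_le1// ltW.
have f2 : dotp f f <= 2.
  have -> : dotp f f = (a ^+ 2 + 1) * dotp e e by rewrite /dotp/=; ring.
  by rewrite ee mulr1 [leRHS](_ : 2 = 1 + 1)// lerD2r.
have g2 : dotp g g <= 2.
  have -> : dotp g g = (a ^+ 2 + 1) * dotp e e by rewrite /dotp/=; ring.
  by rewrite ee mulr1 [leRHS](_ : 2 = 1 + 1)// lerD2r.
have e2 : dotp e e <= 2 by rewrite ee ler1n.
have drift_e : c <= \int[P]_w dotp (Z 0 w) e.
  by rewrite drift ee mulr1 cE ler_piMl// ltW.
have drift_f : c <= \int[P]_w dotp (Z 0 w) f.
  rewrite drift (_ : dotp e f = a * dotp e e); last by rewrite /dotp/=; ring.
  by rewrite ee mulr1 cE mulrC.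
have drift_g : c <= \int[P]_w dotp (Z 0 w) g.
  rewrite drift (_ : dotp e g = a * dotp e e); last by rewrite /dotp/=; ring.
  by rewrite ee mulr1 cE mulrC.
have drift_e' : 0 <= \int[P]_w dotp (Z 0 w) e'.
  by rewrite drift (_ : dotp e e' = 0) ?mulr0// /dotp/=; ring.
have drift_Ne' : 0 <= \int[P]_w dotp (Z 0 w) (- e').
  by rewrite drift (_ : dotp e (- e') = 0) ?mulr0// /dotp/=; ring.
have drifted V u : excursion Z V -> dotp u u <= 2 -> c <= \int[P]_w dotp (Z 0 w) u ->
    square_integrable P (V u n) /\
    96 * \int[P]_w (V u n w ^+ 2) <= n%:R * (2 / 3 * eps).
  move=> exV u2 cu.
  have [? h] := excursion_second_moment_drift P Z mZ indZ iddZ Z2 V u n c t exV u2 c0 tpos cu.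
  split=> //; have n0 : 0 <= n%:R :> R by exact: ler0n.
  have : n%:R * (2 * \int[P]_w (2 * dotp (Z 0 w) (Z 0 w) *
      (t ^+ 2 < 2 * dotp (Z 0 w) (Z 0 w))%R%:R) + m ^+ 2 / (c * t)) <=
      n%:R * (2 * (eps / 576) + eps / 6 / 96).
    by apply: ler_wpM2l => //; clear -tail2 mct; lra.
  by move: h; rewrite -/m; clear -nt; lra.
have undrifted u : dotp u u <= 2 -> 0 <= \int[P]_w dotp (Z 0 w) u ->
    square_integrable P (undershoot Z u n) /\
    48 * a * \int[P]_w (undershoot Z u n w ^+ 2) <= n%:R * eps.
  move=> u2 u0.
  have [? h] := excursion_second_moment P Z mZ indZ iddZ Z2 _ u n
    (undershoot_excursion Z) u2 u0.
  split=> //; have n0 : 0 <= n%:R :> R by exact: ler0n.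
  have h1 : a * \int[P]_w (undershoot Z u n w ^+ 2) <= a * (n%:R * m).
    by apply: ler_wpM2l => //; exact: ltW.
  have : n%:R * (48 * (a * m)) <= n%:R * eps by exact: ler_wpM2l.
  by clear -h1; lra.
have [x1 E1] := drifted _ e (overshoot_excursion Z) e2 drift_e.
have [x2 E2] := drifted _ e (undershoot_excursion Z) e2 drift_e.
have [x3 E3] := undrifted e' e'2 drift_e'.
have [x4 E4] := undrifted (- e') Ne'2 drift_Ne'.
have [x5 E5] := drifted _ f (overshoot_excursion Z) f2 drift_f.
have [x6 E6] := drifted _ f (undershoot_excursion Z) f2 drift_f.
have [x7 E7] := drifted _ g (overshoot_excursion Z) g2 drift_g.
have [x8 E8] := drifted _ g (undershoot_excursion Z) g2 drift_g.
exists (fun w => 2 * (1 - a) * (overshoot Z e n w + undershoot Z e n w) +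
   a * (undershoot Z e' n w + undershoot Z (- e') n w) +
   (overshoot Z f n w + undershoot Z f n w) +
   (overshoot Z g n w + undershoot Z g n w)).
have F2 : square_integrable P (fun w =>
    2 * (1 - a) * (overshoot Z e n w + undershoot Z e n w) +
   a * (undershoot Z e' n w + undershoot Z (- e') n w) +
   (overshoot Z f n w + undershoot Z f n w) +
   (overshoot Z g n w + undershoot Z g n w)).
  by do 2 (apply: square_integrableD; last exact: square_integrableD);
    apply: square_integrableD; apply: square_integrableZ; exact: square_integrableD.
split => //.
- by move=> w; exact: hull_length_ge.
- by move=> w; apply: hull_length_le => //; rewrite a0.
have [_ i1] := x1; have [_ i2] := x2; have [_ i3] := x3; have [_ i4] := x4.
have [_ i5] := x5; have [_ i6] := x6; have [_ i7] := x7; have [_ i8] := x8.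
have [_ iF] := F2.
have i12 := rintegrableD P _ _ i1 i2; have i34 := rintegrableD P _ _ i3 i4.
have i56 := rintegrableD P _ _ i5 i6; have i78 := rintegrableD P _ _ i7 i8.
have j12 := rintegrableZ P 32 _ i12; have j34 := rintegrableZ P (8 * a ^+ 2) _ i34.
have j56 := rintegrableZ P 8 _ i56; have j78 := rintegrableZ P 8 _ i78.
have k1 := rintegrableD P _ _ j12 j34; have k2 := rintegrableD P _ _ k1 j56.
have k3 := rintegrableD P _ _ k2 j78.
have a01 : 0 <= a <= 1 by rewrite (ltW a0).
apply: le_trans (Rint_le P _ _ iF k3 (fun w => sqr_weighted_sum_le _ _ _ _ _ _ _ _ _ a01)) _.
rewrite (RintD P _ _ k2 j78) (RintD P _ _ k1 j56) (RintD P _ _ j12 j34).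
rewrite (RintZ P _ _ i12) (RintZ P _ _ i34) (RintZ P _ _ i56) (RintZ P _ _ i78).
rewrite (RintD P _ _ i1 i2) (RintD P _ _ i3 i4) (RintD P _ _ i5 i6) (RintD P _ _ i7 i8).
(* Of the two factors [a], one compensates [m] and the other is bounded by 1. *)
have sq_small x : 0 <= x -> 48 * a * x <= n%:R * eps -> 8 * a ^+ 2 * x <= n%:R * eps / 6.
  move=> x0 h; have : a * (a * x) <= 1 * (a * x).
    by apply: ler_wpM2r => //; rewrite mulr_ge0// ltW.
  by clear -h; lra.
have s3 := sq_small _ (Rint_ge0 P _ (fun w => sqr_ge0 _)) E3.
have s4 := sq_small _ (Rint_ge0 P _ (fun w => sqr_ge0 _)) E4.
clear -s3 s4 E1 E2 E5 E6 E7 E8; lra.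
Qed.

Theorem theorem1p1 (d : measure_display) (T : measurableType d) (R : realType)
  (P : probability T R) (Z : nat -> T -> R * R) :
  (forall i, measurable_fun setT (Z i)) ->
  mutually_independent P Z ->
  identically_distributed P Z ->
  ('E_P[fun w => (enorm (Z 0%N w) ^+ 2)%R] < +oo)%E ->
  enorm (mean_vec P Z) != 0 ->
  let mu := mean_vec P Z in
  let E2 := ('E_P[fun w => (dotp (vsub (Z 0%N w) mu) mu ^+ 2)%R])%E in
  (E2 < +oo)%E /\
  ((fun n : nat => ((n%:R)^-1)%R%:E * 'V_P[hull_length Z n])%E @ \oo
     --> ((4 / enorm mu ^+ 2)%R%:E * E2)%E).
Proof.
move=> mZ indZ iddZ finZ nu0 mu E2.
have enorm2 (z : R * R) : enorm z ^+ 2 = dotp z z by rewrite sqr_sqrtr// dotp_ge0.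
have Z2 : rintegrable P (fun w => dotp (Z 0 w) (Z 0 w)).
  apply/integrableP; split.
    apply/measurable_EFinP.
    have mzz : measurable_fun setT (fun z : R * R => dotp z z).
      by apply: measurable_funD; apply: measurable_funM.
    exact: measurableT_comp mzz (mZ 0%N).
  apply: le_lt_trans finZ; rewrite unlock le_eqVlt; apply/orP; left; apply/eqP.
  by apply: eq_integral => w _; rewrite enorm2 /= ger0_norm// dotp_ge0.
pose nu := enorm mu.
have nupos : 0 < nu by rewrite lt0r nu0 sqrtr_ge0.
have mean_dotp u : \int[P]_w dotp (Z 0 w) u = dotp mu u.
  have coord1 : rintegrable P (fun w => (Z 0%N w).1).
    have := square_integrableW P _ (square_integrable_step P Z mZ iddZ Z2 0 (1, 0)).
    by congr rintegrable; apply/funext => w; rewrite /dotp/=; ring.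
  have coord2 : rintegrable P (fun w => (Z 0%N w).2).
    have := square_integrableW P _ (square_integrable_step P Z mZ iddZ Z2 0 (0, 1)).
    by congr rintegrable; apply/funext => w; rewrite /dotp/=; ring.
  have -> : dotp mu u = u.1 * \int[P]_w (Z 0%N w).1 + u.2 * \int[P]_w (Z 0%N w).2.
    by rewrite /dotp /mu /mean_vec/= unlock mulrC [X in _ + X]mulrC.
  rewrite -(RintZ P _ _ coord1) -(RintZ P _ _ coord2).
  rewrite -(RintD P _ _ (rintegrableZ P _ _ coord1) (rintegrableZ P _ _ coord2)).
  by apply: eq_Rintegral => w _; rewrite /dotp; ring.
pose e : R * R := (mu.1 / nu, mu.2 / nu).
have nune0 : nu != 0 by [].
have nuE : dotp mu mu = nu ^+ 2 by rewrite enorm2.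
have ee : dotp e e = 1.
  have -> : dotp e e = dotp mu mu / nu ^+ 2 by rewrite /dotp/=; field.
  by rewrite nuE divff// expf_neq0.
have drift u : \int[P]_w dotp (Z 0 w) u = nu * dotp e u.
  by rewrite mean_dotp /dotp/=; field.
have drift_e : \int[P]_w dotp (Z 0 w) e = nu by rewrite drift ee mulr1.
pose s2 := \int[P]_w ((dotp (Z 0 w) e - nu) ^+ 2).
have dev2 : square_integrable P (fun w => dotp (Z 0 w) e - nu).
  exact: (square_integrableD P _ _ (square_integrable_step P Z mZ iddZ Z2 0 e)
    (square_integrable_cst P (- nu))).
have E2E : E2 = (nu ^+ 2 * s2)%:E.
  have [_ di] := dev2.
  rewrite /s2 -(RintZ P _ _ di) Rint_fineK; last exact: rintegrableZ.
  rewrite /E2 unlock; apply: eq_integral => w _; congr EFin.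
  have -> : dotp (vsub (Z 0 w) mu) mu = nu * (dotp (Z 0 w) e - nu).
    by rewrite dotp_vsub nuE mulrBr -expr2; congr (_ - _); rewrite /dotp/=; field.
  by rewrite exprMn.
split; first by rewrite E2E ltry.
have -> : ((4 / enorm mu ^+ 2)%R%:E * E2)%E = (4 * s2)%:E.
  by rewrite E2E -EFinM; congr EFin; rewrite -/nu; field.
have s20 : 0 <= s2 by apply: Rint_ge0 => w; exact: sqr_ge0.
have var_bound (eps : R) : 0 < eps -> exists N, forall n, (N <= n)%N ->
    ((n%:R * (4 * s2 - eps))%:E <= 'V_P[hull_length Z n] <=
     (n%:R * (4 * s2 + eps))%:E)%E.
  move=> eps0.
  (* Half of [eps] pays for [del E Y^2 = del n 4 s2]; adding [eps] to the denominator covers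
     [s2 = 0]. *)
  pose del := eps / (8 * s2 + eps).
  have den0 : 0 < 8 * s2 + eps by lra.
  have del0 : 0 < del by exact: divr_gt0.
  have dels : del * (4 * s2) <= eps / 2.
    have : del * (8 * s2 + eps) = eps by rewrite divfK// gt_eqF.
    by have := mulr_ge0 (ltW del0) (ltW eps0); lra.
  clearbody del.
  (* Chosen so that [(1 + 1 / del) * 4 * eps'] is the other half of [eps]. *)
  pose eps' := eps / (8 * (1 + del^-1)).
  have dV0 : 0 < 1 + del^-1 by rewrite addr_gt0// invr_gt0.
  have eps'0 : 0 < eps' by rewrite divr_gt0// mulr_gt0.
  have [N HN] := hull_length_approx P Z e nu eps' mZ indZ iddZ Z2 ee nupos drift eps'0.
  exists N => n /HN[F [F2 Llb Lub EF]].
  have [S2 [S0 SE]] := walk_variance P Z mZ indZ iddZ Z2 e n.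
  rewrite drift_e in S2 S0 SE.
  pose Y w := 2 * \sum_(i < n) (dotp (Z i w) e - nu).
  have Y2 : square_integrable P Y by exact: square_integrableZ.
  have Y0 : \int[P]_w Y w = 0.
    by rewrite (RintZ P _ _ (square_integrableW P _ S2)) S0 mulr0.
  have YE : \int[P]_w (Y w ^+ 2) = n%:R * (4 * s2).
    have [_ Si] := S2.
    have -> : \int[P]_w (Y w ^+ 2) =
        \int[P]_w (4 * (\sum_(i < n) (dotp (Z i w) e - nu)) ^+ 2).
      by apply: eq_Rintegral => w _; rewrite /Y exprMn; congr (_ * _); ring.
    by rewrite (RintZ P _ _ Si) SE -/s2; ring.
  have walkE w : 2 * dotp (walk Z n w) e = 2 * (n%:R * nu) + Y w.
    rewrite /Y dotp_walk -mulrDr; congr (2 * _).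
    by rewrite [in RHS]big_split/= big_const_ord iter_addr_0 mulNrn -mulr_natl; ring.
  have L0 w : 0 <= hull_length Z n w.
    by apply: sumr_ge0 => a _; apply: sumr_ge0 => b _; exact: sqrtr_ge0.
  have b0 : 0 <= 2 * (n%:R * nu) by rewrite !mulr_ge0// ltW.
  have LY w : 2 * (n%:R * nu) + Y w <= hull_length Z n w by rewrite -walkE.
  have LF w : hull_length Z n w <= 2 * (n%:R * nu) + Y w + F w by rewrite -walkE.
  have := variance_sandwich P _ _ _ _ _ _ del0 b0 Y2 F2 Y0 L0 LY LF erefl.
  have Hle : del * \int[P]_w (Y w ^+ 2) + (1 + del^-1) * (4 * \int[P]_w (F w ^+ 2))
      <= n%:R * eps.
    have n0 : 0 <= n%:R :> R by exact: ler0n.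
    have h1 : n%:R * (del * (4 * s2)) <= n%:R * (eps / 2) by exact: ler_wpM2l.
    have h2 : (1 + del^-1) * (4 * \int[P]_w (F w ^+ 2)) <=
        (1 + del^-1) * (4 * (eps' * n%:R)).
      by apply: ler_wpM2l; [exact: ltW|rewrite ler_pM2l].
    have h3 : (1 + del^-1) * (4 * (eps' * n%:R)) = n%:R * (eps / 2).
      by rewrite /eps'; field; rewrite !gt_eqF ?addr_gt0.
    by rewrite YE; clear -h1 h2 h3; lra.
  rewrite YE in Hle *; move=> /andP[Vlb Vub]; apply/andP; split.
    by apply: le_trans Vlb; rewrite lee_fin; clear -Hle; lra.
  by apply: le_trans Vub _; rewrite lee_fin; clear -Hle; lra.
(* The variance is known to be finite only for large [n], so the passage to real sequences is an
   eventual equality. *)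
have near_real : \forall n \near \oo, ((n%:R)^-1%:E * 'V_P[hull_length Z n])%E
    = (n%:R^-1 * fine 'V_P[hull_length Z n])%:E.
  have [N HN] := var_bound 1 ltr01.
  exists N => // n /= /HN /andP[lb ub]; rewrite EFinM fineK// fin_numE.
  by rewrite gt_eqF ?(lt_le_trans (ltNyr _) lb)//= lt_eqF// (le_lt_trans ub)// ltry.
apply/fine_cvgP; split.
  by apply: filterS near_real => n ->.
apply/cvgrPdist_le => eps eps0.
have [N HN] := var_bound eps eps0.
(* This excludes [n = 0], where the inverse is zero by convention and cannot be cancelled. *)
have Npos : \forall n \near \oo, (maxn N 1 <= n)%N by exact: nbhs_infty_ge.
apply: filterS2 near_real Npos => n nE; rewrite geq_max => /andP[Nn n1].
have /andP[lb ub] := HN n Nn.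
rewrite /= nE /=; have n0 : 0 < n%:R :> R by rewrite ltr0n.
have [v vE] : exists v, ('V_P[hull_length Z n] = v%:E)%E.
  exists (fine 'V_P[hull_length Z n]%E); rewrite fineK// fin_numE.
  by rewrite gt_eqF ?(lt_le_trans (ltNyr _) lb)//= lt_eqF// (le_lt_trans ub)// ltry.
rewrite vE !lee_fin in lb ub; rewrite vE /=.
rewrite distrC ler_distl -(ler_pM2l n0) -[X in _ && X](ler_pM2l n0).
by rewrite mulVKf ?gt_eqF// lb.
Qed.
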